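(* Suppose that $A$ is surjective (so that there is $\gamma>0$ with $|A^*q|_{\mathcal E'}\ge\gamma|q|_{\mathcal F'}$ for all $q\in\mathcal F'$) and that $J:\mathcal E\to[0,\infty)$ satisfies (J1), (J2), (J3), (J4). Let $f\in W^{1,2}([0,T];\mathcal F)$, and let $v_0$ be a critical point of $J$ on the affine space $\mathbf A(f(0))$. Then there exist bounded and measurable functions $v:[0,T]\to\mathcal E$ and $q:[0,T]\to\mathcal F'$ such that: (a) $v$ is an approximable quasistatic evolution (without dissipation) with initial condition $v_0$ and constraint $f$; (b) $A^*q(t)\in\partial J(v(t))$ for every $t\in[0,T]$; (c) the function $s\mapsto\langle q(s),\dot f(s)\rangle_{\mathcal F}$ belongs to $L^1(0,T)$, and for every $t\in(0,T]$ $$J(v(t))\le J(v_0)+\int_0^t\langle q(s),\dot f(s)\rangle_{\mathcal F}\,\mathrm ds.$$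
   Context: Setting: $\mathcal E\simeq\mathbb R^n$ and $\mathcal F\simeq\mathbb R^m$ are Euclidean spaces with $n>m$, with duals $\mathcal E',\mathcal F'$; $A:\mathcal E\to\mathcal F$ is linear with adjoint $A^*:\mathcal F'\to\mathcal E'$; $T>0$; $\langle\cdot,\cdot\rangle$ denotes duality. For $g\in\mathcal F$, $\mathbf A(g):=\{v\in\mathcal E: Av=g\}$. Functions in $W^{1,2}([0,T];\mathcal F)$ are identified with their absolutely continuous representatives. $\mathbb N_0=\mathbb N\cup\{0\}$. Functions $v$ are defined at every $t$ (not identified up to null sets). Fréchet subdifferential of $S:\mathcal E\to[0,\infty)$ at $u$: $\xi\in\partial S(u)\subset\mathcal E'$ iff $\liminf_{v\to u}\frac{S(v)-S(u)-\langle\xi,v-u\rangle_{\mathcal E}}{|v-u|_{\mathcal E}}\ge0$. Critical point: $u$ is a critical point of $S$ on $\mathbf A(g)$ if $Au=g$ and $\partial S(u)\cap\operatorname{ran}(A^* )\ne\emptyset$. Strong convexity: a convex $S:\mathcal E\to[0,\infty)$ is strongly convex if there is $\nu>0$ with $\nu|v_1-v_2|_{\mathcal E}^2\le\langle\xi_1-\xi_2,v_1-v_2\rangle_{\mathcal E}$ for all $v_1,v_2$, $\xi_1\in\partial S(v_1)$, $\xi_2\in\partial S(v_2)$. Assumptions on $J$: (J1) $v\mapsto J(v)+|Av|_{\mathcal F}^2$ is coercive (bounded sublevels); (J2) there is $\eta>0$ such that $v\mapsto J(v)+\eta|v|_{\mathcal E}^2$ is strongly convex; (J3) there is $L>0$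 such that for every $v\in\mathcal E$, $\xi\in\partial J(v)$ implies $|\xi|_{\mathcal E'}\le L(J(v)+1)$; (J4) with $\eta$ as in (J2) and $J_{\eta,\overline v}(v):=J(v)+\eta|v-\overline v|_{\mathcal E}^2$, there is a constant $C_{J,\eta}>0$ such that for every $\overline v\in\mathcal E$: if $A^*q_i\in\partial J_{\eta,\overline v}(v_i)$ for $i=1,2$, then $\langle q_1-q_2,Av_1-Av_2\rangle_{\mathcal F}\le C_{J,\eta}|v_1-v_2|_{\mathcal E}|Av_1-Av_2|_{\mathcal F}$. Discrete quasistatic evolution (without dissipation) with time step $\delta>0$, initial condition $v_0$ and constraint $f$: a right-continuous $v_\delta:[-\delta,T]\to\mathcal E$ such that $v_\delta(t)=v_0$ for $t\in[-\delta,\delta)$; $v_\delta$ is constant on $[0,T]\cap[i\delta,(i+1)\delta)$ for all $i\in\mathbb N_0$ with $i\delta\le T$; and $v_\delta(i\delta)$ is a critical point of $J$ on $\mathbf A(f(i\delta))$ for every $i\in\mathbb N_0$ with $i\delta\le T$. Approximable quasistatic evolution with initial condition $v_0$ and constraint $f$: a bounded measurable $v:[0,T]\to\mathcal E$ such that there exist a sequence $\delta_k\to0^+$ and discrete quasistatic evolutions $v_{\delta_k}$ with time step $\delta_k$, initial condition $v_0$ and constraint $f$, with $\liminf_{k\to\infty}|v_{\delta_k}(t)-v(t)|_{\mathcal E}=0$ for every $t\in[0,T]$. *)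

(* Defs.v *)
From HB Require Import structures.
From mathcomp Require Import all_boot all_order all_algebra.
From mathcomp Require Import all_classical all_reals all_analysis.

Set Implicit Arguments.
Unset Strict Implicit.
Unset Printing Implicit Defensive.

Import Order.TTheory GRing.Theory Num.Theory.
Import numFieldNormedType.Exports.

Local Open Scope classical_set_scope.
Local Open Scope ring_scope.

(* The Euclidean spaces E and F are column vectors 'cV[R]_n and 'cV[R]_m; their
   duals E' and F' are row vectors.  A linear map A : E -> F is a matrix acting
   by v |-> A *m v, and its adjoint A^* : F' -> E' is q |-> q *m A. *)

(* Euclidean norm; the library's `|M| on matrices is the sup norm, which induces
   the same topology.  On row vectors it is the norm dual to the one on column
   vectors. *)
Definition enorm (R : realType) (p q : nat) (M : 'M[R]_(p, q)) : R :=
  Num.sqrt (\sum_(i < p) \sum_(j < q) M i j ^+ 2).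

Definition duality (R : realType) (n : nat) (xi : 'rV[R]_n) (v : 'cV[R]_n) : R :=
  (xi *m v) 0 0.

Section ConstrainedCriticalPoints.
Variables (R : realType) (m n : nat).
Implicit Types (S J : 'cV[R]_n -> R) (A : 'M[R]_(m, n)) (u v : 'cV[R]_n).

(* Fréchet subdifferential. *)
Definition subdifferential S u : set 'rV[R]_n :=
  [set xi | (0 <= limf_einf
     (fun v => ((S v - S u - duality xi (v - u)) / enorm (v - u))%:E) u^')%E].

Definition critical_point S A (g : 'cV[R]_m) u : Prop :=
  A *m u = g /\ exists q : 'rV[R]_m, subdifferential S u (q *m A).

Definition strongly_convex S : Prop :=
  convex_function setT S /\
  exists2 nu : R, 0 < nu &
    forall v1 v2 (xi1 xi2 : 'rV[R]_n),
      subdifferential S v1 xi1 -> subdifferential S v2 xi2 ->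
      nu * enorm (v1 - v2) ^+ 2 <= duality (xi1 - xi2) (v1 - v2).

Definition coercive S : Prop :=
  forall c : R, exists M : R, forall v, S v <= c -> enorm v <= M.

Definition assumption_J1 J A : Prop :=
  coercive (fun v => J v + enorm (A *m v) ^+ 2).

Definition assumption_J2 J (eta : R) : Prop :=
  strongly_convex (fun v => J v + eta * enorm v ^+ 2).

Definition assumption_J3 J : Prop :=
  exists2 L : R, 0 < L &
    forall v (xi : 'rV[R]_n), subdifferential J v xi -> enorm xi <= L * (J v + 1).

Definition perturbed J (eta : R) (vbar : 'cV[R]_n) : 'cV[R]_n -> R :=
  fun v => J v + eta * enorm (v - vbar) ^+ 2.

Definition assumption_J4 J A (eta : R) : Prop :=
  exists2 C : R, 0 < C &
    forall (vbar v1 v2 : 'cV[R]_n) (q1 q2 : 'rV[R]_m),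
      subdifferential (perturbed J eta vbar) v1 (q1 *m A) ->
      subdifferential (perturbed J eta vbar) v2 (q2 *m A) ->
      duality (q1 - q2) (A *m v1 - A *m v2) <=
        C * enorm (v1 - v2) * enorm (A *m v1 - A *m v2).

End ConstrainedCriticalPoints.

(* Functions on [0, T] are functions on R of which only the values on [0, T]
   matter. *)
Section FunctionsOfTime.
Variables (R : realType) (T : R) (p q : nat).
Implicit Types (g : R -> 'M[R]_(p, q)).

Definition bounded_on g : Prop :=
  exists M : R, forall t, t \in `[0, T] -> enorm (g t) <= M.

Definition mx_measurable_on g : Prop :=
  forall i j, measurable_fun `[0, T] (fun t => g t i j).

Definition square_integrable_on g : Prop :=
  mx_measurable_on g /\
  (@lebesgue_measure R).-integrable `[0, T] (fun t => (enorm (g t) ^+ 2)%:E).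

Definition absolutely_continuous_on g : Prop :=
  forall e : R, 0 < e -> exists2 d : R, 0 < d &
    forall (N : nat) (a b : 'I_N -> R),
      (forall i, 0 <= a i /\ a i <= b i /\ b i <= T) ->
      (forall i j, i != j -> b i <= a j \/ b j <= a i) ->
      \sum_(i < N) (b i - a i) < d ->
      \sum_(i < N) enorm (g (b i) - g (a i)) < e.

(* C^1 functions with compact support in the open interval (0, T). *)
Definition test_function (phi : R -> R) : Prop :=
  [/\ forall t, derivable phi t 1,
      continuous (derive1 phi)
    & exists a b : R, [/\ 0 < a, a <= b, b < T
        & forall t, t \notin `[a, b] -> phi t = 0]].

(* g is the absolutely continuous representative of an element of
   W^{1,2}([0, T]) whose weak derivative is (represented by) dg. *)
Definition sobolev_W12 g (dg : R -> 'M[R]_(p, q)) : Prop :=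
  [/\ absolutely_continuous_on g, square_integrable_on g,
      square_integrable_on dg
    & forall phi, test_function phi -> forall i j,
        \int[lebesgue_measure]_(t in `[0, T]) (g t i j * derive1 phi t) =
        - \int[lebesgue_measure]_(t in `[0, T]) (dg t i j * phi t)].

End FunctionsOfTime.

Section QuasistaticEvolutions.
Variables (R : realType) (m n : nat).
Variables (J : 'cV[R]_n -> R) (A : 'M[R]_(m, n)) (T : R).
Variables (v0 : 'cV[R]_n) (f : R -> 'cV[R]_m).

(* vd is defined on [-delta, T], hence the intersections with t <= T. *)
Definition discrete_quasistatic_evolution (delta : R) (vd : R -> 'cV[R]_n) : Prop :=
  [/\ forall t, - delta <= t < T -> vd x @[x --> t^'+] --> vd t,
      forall t, - delta <= t < delta -> t <= T -> vd t = v0,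
      forall i : nat, i%:R * delta <= T ->
        forall s t, s \in `[0, T] -> t \in `[0, T] ->
          i%:R * delta <= s < i.+1%:R * delta ->
          i%:R * delta <= t < i.+1%:R * delta -> vd s = vd t
    & forall i : nat, i%:R * delta <= T ->
        critical_point J A (f (i%:R * delta)) (vd (i%:R * delta))].

Definition approximable_quasistatic_evolution (v : R -> 'cV[R]_n) : Prop :=
  [/\ bounded_on T v, mx_measurable_on T v
    & exists (delta : nat -> R) (vd : nat -> R -> 'cV[R]_n),
        [/\ forall k, 0 < delta k,
            delta @ \oo --> 0,
            forall k, discrete_quasistatic_evolution (delta k) (vd k)
          & forall t, t \in `[0, T] ->
              limn_einf (fun k => (enorm (vd k t - v t))%:E) = 0%E]].

End QuasistaticEvolutions.

(* Main.v *)
Require Import Defs.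
From HB Require Import structures.
From mathcomp Require Import all_boot all_order all_algebra.
From mathcomp Require Import all_classical all_reals all_analysis.
From mathcomp Require Import measurable_realfun ring lra.

Set Implicit Arguments.
Unset Strict Implicit.
Unset Printing Implicit Defensive.

Import Order.TTheory GRing.Theory Num.Theory.
Import numFieldNormedType.Exports.

Local Open Scope classical_set_scope.
Local Open Scope ring_scope.

(** Write S = J + eta |.|^2, a strongly convex function.  Since J is semiconvex, a
Frechet subgradient xi of J at v is the same thing as a global one with a
quadratic defect,
  J w >= J v + <xi, w - v> - eta |w - v|^2   for all w
([subdifferentialP]).  In this form the graph of the subdifferential is closed,
because J, being a finite convex function minus a quadratic, is continuous.

One time step.  Let A^* q be a subgradient of J at v, with A v = g, and let g'
be the next value of the constraint.  The proximal problem
  min { J w + eta |w - v|^2 : A w = g' }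
has a solution w with a multiplier q' ([prox_step_exists]): both are obtained
as limits for the penalized problems in which the constraint is replaced by a
term k |A w - g'|^2; their multipliers -2 k (A w_k - g') are bounded by (J3)
and the surjectivity of A.  Strong convexity gives nu |w - v|^2 <=
<q' - q, g' - g> and (J4) bounds the right-hand side by C |w - v| |g' - g|, so
|w - v| is of order |g' - g| and
  J w <= J v + <q, g' - g> + C' |g' - g|^2
([first_prox_step_energy]).  Iterating the proximal step with the constraint
kept fixed decreases J and the increments tend to 0, so that a cluster point
is a critical point on the affine space of g', with no more energy
([prox_iteration_limit]).

Discrete evolutions.  The steps are chained at the times i delta.  By (J3) the
multipliers are controlled by the energy, and a discrete Gronwall argument
bounds the energies by the total variation of f, uniformly in delta.  The
increments of f being integrals of its weak derivative
([weak_derivative_integral]), summing the energy inequalities gives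
  J (v_delta t) <= J v0 + int_0^t <q_delta, f'> + O(omega)
where omega is the modulus of continuity of f at scale delta
([discrete_evolution]).

The limit.  Let theta_k = <q_k, f'> for a sequence delta_k -> 0.  All theta_k
are dominated by a multiple of |f'|, so the reverse Fatou lemma bounds the
upper limit of the integrals by the integral of limsup theta_k.  It remains to
choose, at each time s, a subsequence along which v_k s and q_k s converge and
theta_k s tends to its upper limit; then <q s, f' s> = limsup theta_k s.  The
subsequence depends on s, and for the limits to be measurable the indices must
be measurable functions of s: this is a Bolzano-Weierstrass theorem with
measurable selection, made of [measurable_limsup_index] for one real sequence
and [measurable_cvg_index] for finitely many. *)

(** * Euclidean norms, duality and entrywise convergence *)

Section Euclidean.
Context {R : realType}.

Lemma dualityE (n : nat) (xi : 'rV[R]_n) (v : 'cV[R]_n) :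
  duality xi v = \sum_i xi 0 i * v i 0.
Proof. by rewrite /duality mxE. Qed.

Lemma dualityDl (n : nat) (xi1 xi2 : 'rV[R]_n) (v : 'cV[R]_n) :
  duality (xi1 + xi2) v = duality xi1 v + duality xi2 v.
Proof. by rewrite /duality mulmxDl mxE. Qed.

Lemma dualityDr (n : nat) (xi : 'rV[R]_n) (v w : 'cV[R]_n) :
  duality xi (v + w) = duality xi v + duality xi w.
Proof. by rewrite /duality mulmxDr mxE. Qed.

Lemma dualityNl (n : nat) (xi : 'rV[R]_n) (v : 'cV[R]_n) :
  duality (- xi) v = - duality xi v.
Proof. by rewrite /duality mulNmx mxE. Qed.

Lemma dualityNr (n : nat) (xi : 'rV[R]_n) (v : 'cV[R]_n) :
  duality xi (- v) = - duality xi v.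
Proof. by rewrite /duality mulmxN mxE. Qed.

Lemma dualityZl (n : nat) (xi : 'rV[R]_n) (c : R) (v : 'cV[R]_n) :
  duality (c *: xi) v = c * duality xi v.
Proof. by rewrite /duality -scalemxAl mxE. Qed.

Lemma dualityZr (n : nat) (xi : 'rV[R]_n) (c : R) (v : 'cV[R]_n) :
  duality xi (c *: v) = c * duality xi v.
Proof. by rewrite /duality -scalemxAr mxE. Qed.

Lemma duality_adj (m n : nat) (q : 'rV[R]_m) (A : 'M[R]_(m, n))
    (v : 'cV[R]_n) :
  duality (q *m A) v = duality q (A *m v).
Proof. by rewrite /duality mulmxA. Qed.

Lemma duality_trC (n : nat) (u v : 'cV[R]_n) : duality u^T v = duality v^T u.
Proof. by rewrite !dualityE; apply: eq_bigr => i _; rewrite !mxE mulrC. Qed.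

Lemma enorm_ge0 (p q : nat) (M : 'M[R]_(p, q)) : 0 <= enorm M.
Proof. exact: sqrtr_ge0. Qed.

Lemma sqr_enormE (p q : nat) (M : 'M[R]_(p, q)) :
  enorm M ^+ 2 = \sum_i \sum_j M i j ^+ 2.
Proof.
rewrite sqr_sqrtr//; apply: sumr_ge0 => i _; apply: sumr_ge0 => j _.
exact: sqr_ge0.
Qed.

Lemma sqr_enorm_duality (n : nat) (v : 'cV[R]_n) :
  enorm v ^+ 2 = duality v^T v.
Proof.
rewrite sqr_enormE dualityE; apply: eq_bigr => i _.
by rewrite big_ord1 mxE expr2.
Qed.

Lemma sqr_enormD (n : nat) (u v : 'cV[R]_n) :
  enorm (u + v) ^+ 2 = enorm u ^+ 2 + 2 * duality u^T v + enorm v ^+ 2.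
Proof.
rewrite !sqr_enorm_duality linearD/= dualityDl !dualityDr (duality_trC v u).
by ring.
Qed.

Lemma sqr_enormZ (p q : nat) (c : R) (M : 'M[R]_(p, q)) :
  enorm (c *: M) ^+ 2 = c ^+ 2 * enorm M ^+ 2.
Proof.
rewrite !sqr_enormE mulr_sumr; apply: eq_bigr => i _.
by rewrite mulr_sumr; apply: eq_bigr => j _; rewrite mxE exprMn.
Qed.

Lemma enormN (p q : nat) (M : 'M[R]_(p, q)) : enorm (- M) = enorm M.
Proof.
by congr Num.sqrt; apply: eq_bigr => i _; apply: eq_bigr => j _; rewrite mxE sqrrN.
Qed.

Lemma enorm0 (p q : nat) : enorm (0 : 'M[R]_(p, q)) = 0.
Proof.
apply/eqP; rewrite -[_ == _](@expf_eq0 _ _ 2) sqr_enormE big1// => i _.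
by rewrite big1// => j _; rewrite mxE expr0n.
Qed.

Lemma sqr_enormB (n : nat) (u v : 'cV[R]_n) :
  enorm (u - v) ^+ 2 = enorm u ^+ 2 - 2 * duality u^T v + enorm v ^+ 2.
Proof. by rewrite sqr_enormD dualityNr enormN; ring. Qed.

Lemma entry_le_enorm (p q : nat) (M : 'M[R]_(p, q)) i j : `|M i j| <= enorm M.
Proof.
rewrite -sqrtr_sqr ler_sqrt; last first.
  by apply: sumr_ge0 => k _; apply: sumr_ge0 => l _; exact: sqr_ge0.
rewrite (bigD1 i)//= (bigD1 j)//= -addrA lerDl addr_ge0//.
  by apply: sumr_ge0 => l _; exact: sqr_ge0.
by apply: sumr_ge0 => k _; apply: sumr_ge0 => l _; exact: sqr_ge0.
Qed.

Lemma sum_sqr_le (I : Type) (r : seq I) (F : I -> R) :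
  (forall i, 0 <= F i) -> \sum_(i <- r) F i ^+ 2 <= (\sum_(i <- r) F i) ^+ 2.
Proof.
move=> F0; elim: r => [|i r IH]; first by rewrite !big_nil expr0n.
rewrite !big_cons sqrrD -addrA lerD2l (le_trans IH)// lerDr mulrn_wge0//.
by rewrite mulr_ge0// sumr_ge0.
Qed.

Lemma enorm_le_sum (p q : nat) (M : 'M[R]_(p, q)) :
  enorm M <= \sum_i \sum_j `|M i j|.
Proof.
rewrite -[leRHS]ger0_norm; last first.
  by apply: sumr_ge0 => i _; apply: sumr_ge0.
rewrite -sqrtr_sqr ler_sqrt ?sqr_ge0//.
apply: le_trans; last by apply: sum_sqr_le => i; exact: sumr_ge0.
apply: ler_sum => i _; apply: le_trans; last by apply: sum_sqr_le.
by apply: ler_sum => j _; rewrite real_normK ?num_real.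
Qed.

Lemma enorm_bounded (p q : nat) (M : 'M[R]_(p, q)) (c : R) :
  (forall i j, `|M i j| <= c) -> enorm M <= p%:R * (q%:R * c).
Proof.
move=> Mc; apply: (le_trans (enorm_le_sum _)).
apply: (@le_trans _ _ (\sum_(i < p) \sum_(j < q) c)).
  by apply: ler_sum => i _; apply: ler_sum => j _.
by rewrite !sumr_const !card_ord -[leLHS]mulr_natl -[X in _ * X <= _]mulr_natl.
Qed.

Lemma enormZ (p q : nat) (c : R) (M : 'M[R]_(p, q)) :
  enorm (c *: M) = `|c| * enorm M.
Proof.
apply/eqP; rewrite -(@eqrXn2 _ 2)// ?enorm_ge0 ?mulr_ge0 ?enorm_ge0//.
by rewrite sqr_enormZ exprMn real_normK ?num_real.
Qed.

Lemma enorm_eq0 (p q : nat) (M : 'M[R]_(p, q)) : enorm M = 0 -> M = 0.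
Proof.
move=> M0; apply/matrixP => i j; rewrite mxE; apply/eqP.
by rewrite -normr_le0 -M0 entry_le_enorm.
Qed.

Lemma enorm_gt0 (p q : nat) (M : 'M[R]_(p, q)) : M != 0 -> 0 < enorm M.
Proof.
move=> M0; rewrite lt_neqAle enorm_ge0 andbT eq_sym.
by apply: contra_neq M0 => /enorm_eq0.
Qed.

Lemma enormD_le (p q : nat) (M N : 'M[R]_(p, q)) :
  enorm (M + N) <= p%:R * (q%:R * (enorm M + enorm N)).
Proof.
apply: enorm_bounded => i j; rewrite mxE; apply: (le_trans (ler_normD _ _)).
by rewrite lerD// entry_le_enorm.
Qed.

Lemma enorm_tr (p q : nat) (M : 'M[R]_(p, q)) : enorm M^T = enorm M.
Proof.
congr Num.sqrt; rewrite exchange_big/=.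
by apply: eq_bigr => i _; apply: eq_bigr => j _; rewrite mxE.
Qed.

Lemma normr_duality_le (n : nat) (xi : 'rV[R]_n) (v : 'cV[R]_n) :
  `|duality xi v| <= n%:R * (enorm xi * enorm v).
Proof.
rewrite dualityE; apply: (le_trans (ler_norm_sum _ _ _)).
apply: (@le_trans _ _ (\sum_(i < n) enorm xi * enorm v)).
  by apply: ler_sum => i _; rewrite normrM ler_pM// entry_le_enorm.
by rewrite sumr_const card_ord -[leLHS]mulr_natl.
Qed.

(** A right inverse B of A turns a bound on q *m A into one on q = q *m A *m B. *)
Lemma right_inverse_of_surjective (m n : nat) (A : 'M[R]_(m, n)) :
  (forall g : 'cV[R]_m, exists v : 'cV[R]_n, A *m v = g) ->
  exists B : 'M[R]_(n, m), A *m B = 1%:M.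
Proof.
move=> surj; have /boolp.choice[h hP] : forall j, exists v, A *m v = col j 1%:M.
  by move=> j; exact: surj.
exists (\matrix_(i, j) h j i 0); apply/matrixP => i j.
have := congr1 (fun M : 'cV[R]_m => M i 0) (hP j).
by rewrite !mxE => <-; apply: eq_bigr => k _; rewrite !mxE.
Qed.

Lemma cvg_sum (I : Type) (r : seq I) (F : I -> nat -> R) (l : I -> R) :
  (forall i, F i @ \oo --> l i) ->
  (fun k => \sum_(i <- r) F i k) @ \oo --> \sum_(i <- r) l i.
Proof. by move=> Fl; apply: cvg_big => //; exact: add_continuous. Qed.

(** The indices L j need not be increasing: L j >= j suffices, and this
condition is stable under composition. *)
Lemma cvg_index (u : nat -> R) (l : R) (L : nat -> nat) :
  (forall j, (j <= L j)%N) -> u @ \oo --> l -> (fun j => u (L j)) @ \oo --> l.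
Proof.
move=> jL ul; apply: (cvg_comp L u) ul.
by move=> P [N _ NP]; exists N => // k /= Nk; apply: NP => /=; exact: leq_trans (jL k).
Qed.

(** Entrywise, so that Bolzano-Weierstrass is a statement about finitely many real
sequences. *)
Definition ecvg (p q : nat) (x : nat -> 'M[R]_(p, q)) (l : 'M[R]_(p, q)) :=
  forall i j, (fun k => x k i j) @ \oo --> l i j.

Lemma ecvg_cst (p q : nat) (l : 'M[R]_(p, q)) : ecvg (fun=> l) l.
Proof. by move=> i j; exact: cvg_cst. Qed.

Lemma ecvgD (p q : nat) (x y : nat -> 'M[R]_(p, q)) l k :
  ecvg x l -> ecvg y k -> ecvg (fun i => x i + y i) (l + k).
Proof.
move=> xl yk i j; rewrite mxE.
under eq_fun do rewrite mxE.
by apply: cvgD; [exact: xl|exact: yk].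
Qed.

Lemma ecvgZ (p q : nat) (c : R) (x : nat -> 'M[R]_(p, q)) l :
  ecvg x l -> ecvg (fun i => c *: x i) (c *: l).
Proof.
move=> xl i j; rewrite mxE.
under eq_fun do rewrite mxE.
by apply: cvgMl_tmp; exact: xl.
Qed.

Lemma ecvgN (p q : nat) (x : nat -> 'M[R]_(p, q)) l :
  ecvg x l -> ecvg (fun i => - x i) (- l).
Proof.
move=> xl i j; rewrite mxE.
under eq_fun do rewrite mxE.
by apply: cvgN; exact: xl.
Qed.

Lemma ecvgM (p q r : nat) (x : nat -> 'M[R]_(p, q)) (y : nat -> 'M[R]_(q, r)) l k :
  ecvg x l -> ecvg y k -> ecvg (fun i => x i *m y i) (l *m k).
Proof.
move=> xl yk i j; rewrite mxE.
under eq_fun do rewrite mxE.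
apply: cvg_sum => s; apply: cvgM; [exact: xl|exact: yk].
Qed.

Lemma ecvgT (p q : nat) (x : nat -> 'M[R]_(p, q)) l :
  ecvg x l -> ecvg (fun i => (x i)^T) l^T.
Proof.
move=> xl i j; rewrite mxE.
under eq_fun do rewrite mxE.
exact: xl.
Qed.

Lemma cvg_duality (n : nat) (x : nat -> 'rV[R]_n) (y : nat -> 'cV[R]_n) l k :
  ecvg x l -> ecvg y k ->
  (fun i => duality (x i) (y i)) @ \oo --> duality l k.
Proof. by move=> xl yk; have := ecvgM xl yk; apply. Qed.

Lemma cvg_sqr_enorm (n : nat) (x : nat -> 'cV[R]_n) l :
  ecvg x l -> (fun i => enorm (x i) ^+ 2) @ \oo --> enorm l ^+ 2.
Proof.
move=> xl; rewrite sqr_enorm_duality.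
under eq_fun do rewrite sqr_enorm_duality.
by apply: cvg_duality => //; exact: ecvgT.
Qed.

Lemma ecvg_unique (p q : nat) (x : nat -> 'M[R]_(p, q)) l k :
  ecvg x l -> ecvg x k -> l = k.
Proof.
move=> xl xk; apply/matrixP => i j.
exact: (cvg_unique _ (xl i j) (xk i j)).
Qed.

Lemma ecvg0_enorm (p q : nat) (x : nat -> 'M[R]_(p, q)) :
  (fun k => enorm (x k)) @ \oo --> 0 -> ecvg x 0.
Proof.
move=> x0 i j; rewrite mxE; apply/norm_cvg0P.
apply: (@squeeze_cvgr _ _ _ _ (fun=> 0) (fun k => enorm (x k))) => //.
- by apply: nearW => k; rewrite normr_ge0 entry_le_enorm.
- exact: cvg_cst.
Qed.

Lemma cvg_enorm_sub (p q : nat) (x : nat -> 'M[R]_(p, q)) l :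
  ecvg x l -> (fun k => enorm (x k - l)) @ \oo --> 0.
Proof.
move=> xl.
apply: (@squeeze_cvgr _ _ _ _ (fun=> 0) (fun k => \sum_i \sum_j `|(x k - l) i j|)).
- by apply: nearW => k; rewrite enorm_ge0 enorm_le_sum.
- exact: cvg_cst.
- have l0 : \sum_(i < p) \sum_(j < q) `|(l - l) i j| = 0.
    by rewrite big1// => i _; rewrite big1// => j _; rewrite subrr mxE normr0.
  rewrite -[X in _ --> X]l0.
  apply: (cvg_sum (F := fun i k => \sum_j `|(x k - l) i j|)) => i.
  apply: (cvg_sum (F := fun j k => `|(x k - l) i j|)) => j; apply: cvg_norm.
  by have lN : ecvg (fun=> - l) (- l); [exact: ecvg_cst|have := ecvgD xl lN; apply].
Qed.

Lemma ecvg_subseq (p q : nat) (x : nat -> 'M[R]_(p, q)) l (K : nat -> nat) :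
  (forall j, (j <= K j)%N) -> ecvg x l -> ecvg (fun j => x (K j)) l.
Proof.
by move=> Kj xl i j; exact: (cvg_index (u := fun k => x k i j) Kj (xl i j)).
Qed.

End Euclidean.

(** * Measurable selection of convergent subsequences *)

Section MeasurableSelection.
Context d (T : measurableType d) (R : realType) (D : set T).
Hypothesis mD : measurable D.

Lemma measurable_fun_index d' (Y : measurableType d') (X : nat -> T -> Y)
    (K : T -> nat) :
  measurable_fun D K -> (forall k, measurable_fun D (X k)) ->
  measurable_fun D (fun s => X (K s) s).
Proof.
move=> mK mX _ B mB.
rewrite (_ : _ `&` _ =
    \bigcup_k ((D `&` K @^-1` [set k]) `&` (D `&` X k @^-1` B))).
  by apply: bigcupT_measurable => k; apply: measurableI;
    [exact: mK|exact: mX].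
apply/seteqP; split => [s [Ds Bs]|s [k _ [[Ds /= <-] [_ Bs]]]]//.
by exists (K s).
Qed.

(** Taking the least index makes the selection measurable: the event that k is
selected only involves the predicates P l for l <= k. *)
Lemma measurable_first_index (P : nat -> T -> bool) :
  (forall k, measurable_fun D (P k)) -> (forall s, D s -> exists k, P k s) ->
  exists2 K : T -> nat, measurable_fun D K & forall s, D s -> P (K s) s.
Proof.
move=> mP exP.
pose Q := fix Q k s := if k is k'.+1 then Q k' s && ~~ P k' s else true.
have QP k s : Q k s <-> forall l, (l < k)%N -> ~~ P l s.
  elim: k => [|k IH] /=; first by split.
  split => [/andP[/IH Qk Pk] l|Pl].
    by rewrite ltnS leq_eqVlt => /predU1P[->//|]; exact: Qk.
  by rewrite Pl// andbT; apply/IH => l lk; apply: Pl; exact: ltnW.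
have mQ k : measurable_fun D (Q k).
  elim: k => [|k IH] /=; first exact: measurable_cst.
  by apply: measurable_and => //; exact: measurable_neg.
have /boolp.choice[K KP] : forall s, exists k, D s -> P k s /\ Q k s.
  move=> s; have [Ds|nDs] := pselect (D s); last by exists 0%N.
  have := exP s Ds => /cid ex; have ex' : exists k, P k s by case: ex => k; exists k.
  exists (ex_minn ex') => _; case: ex_minnP => k Pk kmin; split=> //.
  apply/QP => l lk; apply/negP => /kmin; by rewrite leqNgt lk.
exists K => [_ B _|s Ds]; last by have [] := KP s Ds.
rewrite (_ : _ `&` _ =
    \bigcup_(k in B) (D `&` (fun s => P k s && Q k s) @^-1` [set true])).
  apply: bigcup_measurable => k _.
  by apply: (measurable_and (mP k) (mQ k)).
apply/seteqP; split => [s [Ds BKs]|s [k Bk [Ds /= /andP[Pk Qk]]]].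
  by exists (K s) => //; split=> //=; have [-> ->] := KP s Ds.
split => //=; have [PK QK] := KP s Ds.
suff -> : K s = k by [].
apply/eqP; rewrite eqn_leq; apply/andP; split; rewrite leqNgt; apply/negP => lt.
  by move/QP : QK => /(_ _ lt); rewrite Pk.
by move/QP : Qk => /(_ _ lt); rewrite PK.
Qed.

(** K j s is an index k >= j at which X k s is within 1 / (j + 1) of the supremum
of the tail starting at j; these suprema decrease to the upper limit. *)
Lemma measurable_limsup_index (X : nat -> T -> R) :
  (forall k, measurable_fun D (X k)) ->
  (forall s, D s -> exists M, forall k, `|X k s| <= M) ->
  exists K : nat -> T -> nat,
    [/\ forall j, measurable_fun D (K j),
        forall j s, D s -> (j <= K j s)%N
      & forall s, D s -> (fun j => X (K j s) s) @ \oo --> limn_sup (X ^~ s)].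
Proof.
move=> mX bX.
have ub s : D s -> has_ubound (range (X ^~ s)).
  move=> /bX[M hM]; exists M => _ [k _ <-].
  exact: le_trans (ler_norm _) (hM k).
have lb s : D s -> has_lbound (range (X ^~ s)).
  move=> /bX[M hM]; exists (- M) => _ [k _ <-].
  by have := hM k; rewrite ler_norml => /andP[].
have /boolp.choice[K KP] : forall j, exists K : T -> nat,
    measurable_fun D K /\ forall s, D s ->
    (j <= K s)%N && (sups (X ^~ s) j - j.+1%:R^-1 < X (K s) s).
  move=> j; suff [K ? ?] : exists2 K : T -> nat, measurable_fun D K &
      forall s, D s -> (j <= K s)%N && (sups (X ^~ s) j - j.+1%:R^-1 < X (K s) s).
    by exists K.
  apply: (measurable_first_index
    (P := fun k s => (j <= k)%N && (sups (X ^~ s) j - j.+1%:R^-1 < X k s))).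
    move=> k; apply: measurable_and; first exact: measurable_cst.
    apply: measurable_fun_ltr => //; apply: measurable_funB => //.
    exact: measurable_fun_sups.
  move=> s Ds; have supX : has_sup (sdrop (X ^~ s) j).
    by split; [exists (X j s); exists j => /=|exact: has_ubound_sdrop (ub s Ds) j].
  have j0 : 0 < j.+1%:R^-1 :> R by rewrite invr_gt0.
  have [_ [k /= jk <-] Xk] := sup_adherent j0 supX.
  by exists k; rewrite jk.
exists K; split => [j|j s Ds|s Ds]; first exact: (KP j).1.
  by have /andP[] := (KP j).2 s Ds.
have cS : sups (X ^~ s) @ \oo --> limn_sup (X ^~ s).
  have cv := cvg_sups_inf (ub s Ds) (lb s Ds).
  by apply/cvg_ex; eexists; exact: cv.
apply: (@squeeze_cvgr _ _ _ _ (fun j => sups (X ^~ s) j - j.+1%:R^-1)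
  (sups (X ^~ s))) => //.
- apply: nearW => j; have /andP[jK /ltW ->] /= := (KP j).2 s Ds.
  by apply: ub_le_sup; [exact: has_ubound_sdrop (ub s Ds) j|exists (K j s)].
- rewrite -[X in _ --> X]subr0; apply: cvgB => //.
  exact: cvg_harmonic.
Qed.

(** The coordinates are made convergent one after the other, composing the
selected indices; the coordinates treated before still converge. *)
Lemma measurable_cvg_index (I : finType) (X : I -> nat -> T -> R) :
  (forall i k, measurable_fun D (X i k)) ->
  (forall i s, D s -> exists M, forall k, `|X i k s| <= M) ->
  exists K : nat -> T -> nat,
    [/\ forall j, measurable_fun D (K j),
        forall j s, D s -> (j <= K j s)%N
      & forall i s, D s -> cvgn (fun j => X i (K j s) s)].
Proof.
move=> mX bX.
suff [K [mK jK cK]] : exists K : nat -> T -> nat,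
    [/\ forall j, measurable_fun D (K j),
        forall j s, D s -> (j <= K j s)%N
      & forall i s, i \in enum I -> D s -> cvgn (fun j => X i (K j s) s)].
  by exists K; split => // i s; apply: cK; rewrite mem_enum.
elim: (enum I) => [|i r [K [mK jK cK]]].
  by exists (fun j _ => j); split => // j; exact: measurable_cst.
have [k|s Ds|L [mL jL cL]] := @measurable_limsup_index (fun k s => X i (K k s) s).
- by apply: measurable_fun_index => //; exact: mK.
- by have [M hM] := bX i s Ds; exists M.
exists (fun j s => K (L j s) s); split => [j|j s Ds|i' s].
- by apply: (measurable_fun_index (X := fun k s => K k s)).
- exact: leq_trans (jL j s Ds) (jK _ s Ds).
- rewrite inE => /predU1P[->|i'r] Ds.
    by apply/cvg_ex; eexists; exact: cL.
  have /cvg_ex[l cl] := cK i' s i'r Ds.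
  apply/cvg_ex; exists l.
  apply: (cvg_index (u := fun k => X i' (K k s) s) (L := fun j => L j s)) => // j.
  exact: jL.
Qed.

End MeasurableSelection.

(** Bolzano-Weierstrass, as the case of constant functions. *)
Lemma bounded_ecvg_index (R : realType) (p q : nat) (x : nat -> 'M[R]_(p, q)) (M : R) :
  (forall k i j, `|x k i j| <= M) ->
  exists (K : nat -> nat) (l : 'M[R]_(p, q)),
    (forall j, (j <= K j)%N) /\ ecvg (fun j => x (K j)) l.
Proof.
move=> xM.
have [||K [_ jK cK]] := @measurable_cvg_index _ nat R setT measurableT
    ('I_p * 'I_q)%type (fun i k _ => x k i.1 i.2).
- by move=> i k; exact: measurable_cst.
- by move=> i s _; exists M.
exists (fun j => K j 0%N), (\matrix_(i, j) limn (fun k => x (K k 0%N) i j)).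
split => [j|i j]; first exact: jK.
by rewrite mxE; exact: cK (i, j) 0%N _.
Qed.

(** * Convex and semiconvex functions *)

Section ConvexAnalysis.
Context {R : realType} {n : nat}.
Implicit Types (S J : 'cV[R]_n -> R) (u v w : 'cV[R]_n) (xi : 'rV[R]_n).

Definition convex_fun S := forall (t : R) u v, 0 <= t <= 1 ->
  S (v + t *: (u - v)) <= S v + t * (S u - S v).

Lemma convex_function_setT S : convex_function setT S -> convex_fun S.
Proof.
move=> cS t u v t01; have := cS (Itv01 (andP t01).1 (andP t01).2) u v.
rewrite !inE => /(_ I I); rewrite convRE /= /conv/=.
rewrite (_ : v + t *: (u - v) = t *: u + (1 - t) *: v); last first.
  by rewrite scalerBl scale1r scalerBr addrCA.
by move=> /le_trans; apply; rewrite /= /unstable.onem; lra.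
Qed.

Lemma subdifferential_lower S u xi : subdifferential S u xi ->
  forall e : R, 0 < e -> exists2 r : R, 0 < r & forall w, enorm (w - u) < r ->
    - e * enorm (w - u) <= S w - S u - duality xi (w - u).
Proof.
rewrite /subdifferential/= limf_einfE => sub e e0.
have : ((- e)%:E < 0 :> \bar R)%E by rewrite lte_fin oppr_lt0.
move=> /lt_le_trans/(_ sub)/ereal_sup_gt[_ [V uV <-]] eV.
have /nbhs_ballP[r r0 rV] : nbhs u (fun w => w != u -> V w) by exact: uV.
exists r => // w wr; have [->|wu] := eqVneq w u.
  by rewrite !subrr enorm0 /duality mulmx0 mxE mulr0 subr0.
rewrite -ler_pdivlMr ?enorm_gt0 ?subr_eq0// -lee_fin.
apply: (le_trans (ltW eV)); apply: ereal_inf_lbound; exists w => //.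
apply: rV => //; split => // i j; rewrite /ball/= distrC.
by apply: le_lt_trans wr; have := entry_le_enorm (w - u) i j; rewrite !mxE.
Qed.

Lemma lower_subdifferential S u xi :
  (forall e : R, 0 < e -> exists2 r : R, 0 < r & forall w, enorm (w - u) < r ->
    - e * enorm (w - u) <= S w - S u - duality xi (w - u)) ->
  subdifferential S u xi.
Proof.
move=> low; rewrite /subdifferential/= limf_einfE.
apply/lee_addgt0Pr => e e0; rewrite -leeBlDr// sub0e.
have [r r0 rP] := low e e0.
apply: ereal_sup_ge.
exists (ereal_inf [set ((S v - S u - duality xi (v - u)) / enorm (v - u))%:E |
    v in [set v | enorm (v - u) < r /\ v != u]]).
  exists [set v | enorm (v - u) < r /\ v != u] => //.
  apply/nbhs_ballP; exists (r / n.+1%:R); first by rewrite /= divr_gt0.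
  move=> w wr wu; split => //.
  have {}wr i j : `|(w - u) i j| <= r / n.+1%:R.
    by have := wr.2 i j; rewrite /ball/= distrC !mxE => /ltW.
  apply: (le_lt_trans (enorm_bounded wr)); rewrite mul1r mulrCA gtr_pMr//.
  by rewrite ltr_pdivrMr// mul1r ltr_nat.
apply: le_ereal_inf_tmp => _ [w [wr wu] <-].
by rewrite -EFinN lee_fin ler_pdivlMr ?enorm_gt0 ?subr_eq0// rP.
Qed.

Lemma convex_fun_midpoint S v a b : convex_fun S ->
  S (v + (a + b)) <= 2^-1 * (S (v + 2 *: a) + S (v + 2 *: b)).
Proof.
move=> cS; have h01 : 0 <= (2^-1 : R) <= 1 by apply/andP; split; lra.
have := cS _ (v + 2 *: a) (v + 2 *: b) h01.
rewrite (_ : v + 2 *: b + _ = v + (a + b)); last first.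
  rewrite opprD addrACA subrr add0r scalerBr !scalerA mulVf// !scale1r.
  by rewrite -addrA [_ + (a - b)]addrC scaler_nat mulr2n [a - b + _]addrA subrK.
by move=> /le_trans; apply; lra.
Qed.

(** Convexity on [v, v + a] when t >= 0, on [v, v - a] when t < 0. *)
Lemma convex_fun_axis S v a (t : R) : convex_fun S -> `|t| <= 1 ->
  S (v + t *: a) - S v <= (`|S (v + a) - S v| + `|S (v - a) - S v|) * `|t|.
Proof.
move=> cS t1; have [t0|t0] := leP 0 t.
  have := cS t (v + a) v; rewrite addrAC subrr add0r t0 -(ger0_norm t0) t1.
  move=> /(_ isT); set x := S (v + a) - S v.
  have := ler_norm x; have := normr_ge0 (S (v - a) - S v).
  by rewrite !normr_id; have := normr_ge0 t; nra.
have := cS (- t) (v - a) v.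
rewrite addrAC subrr add0r -(ltr0_norm t0) normr_ge0 t1 => /(_ isT).
rewrite scalerN -scaleNr ltr0_norm// opprK; set x := S (v - a) - S v.
have := ler_norm x; have := normr_ge0 (S (v + a) - S v).
by nra.
Qed.

(** The coordinates of the increment are added one at a time: v + (a + b) is the
midpoint of v + 2 a and v + 2 b, whence the halving of rho. *)
Lemma convex_fun_upper S v (r : seq 'I_n) : convex_fun S ->
  exists (B rho : R), 0 < rho /\ forall h : 'I_n -> R, (forall i, `|h i| <= rho) ->
    S (v + \sum_(i <- r) h i *: delta_mx i 0) - S v <= B * \sum_(i <- r) `|h i|.
Proof.
move=> cS; elim: r => [|i r [B [rho [rho0 IH]]]].
  by exists 0, 1; split => // h _; rewrite !big_nil addr0 subrr mulr0.
pose e : 'cV[R]_n := delta_mx i 0.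
pose Bi := `|S (v + e) - S v| + `|S (v - e) - S v|.
exists (`|B| + Bi), (Num.min 1 rho / 2); split => [|h hrho].
  by rewrite divr_gt0// lt_min ltr01.
rewrite !big_cons -/e.
have h1 j : `|2 * h j| <= 1 /\ `|2 * h j| <= rho.
  have := hrho j; rewrite normrM ger0_norm// ler_pdivlMr// mulrC le_min.
  by move/andP.
apply: le_trans (_ : 2^-1 * (S (v + (2 * h i) *: e) - S v) +
   2^-1 * (S (v + \sum_(j <- r) (2 * h j) *: delta_mx j 0) - S v) <= _).
  have := convex_fun_midpoint v (h i *: e) (\sum_(j <- r) h j *: delta_mx j 0) cS.
  rewrite scalerA scaler_sumr.
  rewrite [X in _ + S (v + X)](eq_bigr (fun j => (2 * h j) *: delta_mx j 0)).
    by lra.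
  by move=> j _; rewrite scalerA.
have := convex_fun_axis v e cS (h1 i).1; have := IH (fun j => 2 * h j) (fun j => (h1 j).2).
rewrite -/Bi; under [X in _ <= B * X -> _]eq_bigr do rewrite normrM ger0_norm//.
rewrite -mulr_sumr normrM ger0_norm//.
have := ler_norm B; have : 0 <= \sum_(j <- r) `|h j| by exact: sumr_ge0.
have : 0 <= Bi by rewrite addr_ge0.
set s := \sum_(j <- r) `|h j|; have := normr_ge0 (h i); have := normr_ge0 B.
by nra.
Qed.

(** Upper bounds near l give lower bounds by reflection: l is the midpoint of
l + h and l - h. *)
Lemma convex_fun_continuous S (x : nat -> 'cV[R]_n) l : convex_fun S ->
  ecvg x l -> (fun k => S (x k)) @ \oo --> S l.
Proof.
move=> cS xl; have [B [rho [rho0 up]]] := convex_fun_upper l (index_enum 'I_n) cS.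
have sumE (h : 'cV[R]_n) : h = \sum_i h i 0 *: delta_mx i 0.
  by rewrite {1}[h]matrix_sum_delta; apply: eq_bigr => i _; rewrite big_ord1.
have upper (h : 'cV[R]_n) : enorm h <= rho -> S (l + h) - S l <= B * \sum_i `|h i 0|.
  move=> hrho; rewrite {1}[h]sumE; apply: up => i.
  exact: le_trans (entry_le_enorm _ _ _) hrho.
have lower (h : 'cV[R]_n) : enorm h <= rho -> S l - S (l + h) <= B * \sum_i `|h i 0|.
  move=> hrho.
  have := convex_fun_midpoint l (2^-1 *: h) (2^-1 *: - h) cS.
  rewrite -scalerDr subrr scaler0 addr0 !scalerA mulfV// !scale1r => mid.
  have := upper (- h); rewrite enormN => /(_ hrho).
  by under eq_bigr do rewrite mxE normrN; lra.
have cd : (fun k => enorm (x k - l)) @ \oo --> 0 by exact: cvg_enorm_sub.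
apply/subr_cvg0/norm_cvg0P.
apply: (@squeeze_cvgr _ _ _ _ (fun=> 0) (fun k => `|B| * (n%:R * enorm (x k - l)))).
- have : \forall k \near \oo, enorm (x k - l) <= rho.
    move/cvgr0_norm_le : cd => /(_ _ rho0); apply: filterS => k.
    by rewrite ger0_norm ?enorm_ge0.
  apply: filterS => k xk; rewrite normr_ge0/=.
  apply: le_trans (_ : B * \sum_i `|(x k - l) i 0| <= _).
    have := upper _ xk; have := lower _ xk; rewrite [l + _]addrC subrK => lo hi.
    by rewrite ler_norml hi; lra.
  apply: le_trans (ler_wpM2r _ (ler_norm B)) _; first exact: sumr_ge0.
  rewrite ler_wpM2l//; apply: le_trans (_ : \sum_(i < n) enorm (x k - l) <= _).
    by apply: ler_sum => i _; exact: entry_le_enorm.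
  by rewrite sumr_const card_ord -[leLHS]mulr_natl.
- exact: cvg_cst.
- rewrite -[X in _ --> X](mulr0 `|B|); apply: cvgMl_tmp.
  by rewrite -[X in _ --> X](mulr0 n%:R); apply: cvgMl_tmp.
Qed.

(** Subgradients up to a quadratic error: for a function that becomes convex when
c |.|^2 is added, a local (Frechet) subgradient satisfies this global
inequality, which is stable under limits. *)
Definition prox_subgradient J (c : R) v xi := forall w,
  J v + duality xi (w - v) - c * enorm (w - v) ^+ 2 <= J w.

Section Semiconvex.
Variables (J : 'cV[R]_n -> R) (c : R).
Hypothesis c_ge0 : 0 <= c.
Hypothesis cvxJ : convex_fun (fun v => J v + c * enorm v ^+ 2).

Lemma semiconvex_segment (t : R) u v : 0 <= t <= 1 ->
  J (v + t *: (u - v)) <= J v + t * (J u - J v) + c * (t * (1 - t) * enorm (u - v) ^+ 2).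
Proof.
move=> t01; have := cvxJ u v t01.
have -> : enorm u ^+ 2 = enorm v ^+ 2 + 2 * duality v^T (u - v) + enorm (u - v) ^+ 2.
  by rewrite -sqr_enormD addrC subrK.
rewrite sqr_enormD sqr_enormZ dualityZr.
move=> h; nra.
Qed.

(** A function convex up to c |.|^2 lies, on the segment [v, w], below its chord
up to c t (1 - t) |w - v|^2.  Comparing with the Frechet inequality and
letting t tend to 0 gives the global one. *)
Lemma subdifferentialP v xi : subdifferential J v xi <-> prox_subgradient J c v xi.
Proof.
split => [sub w|sub]; last first.
  apply: lower_subdifferential => e e0; exists (e / (c + 1)) => [|w wr].
    by rewrite divr_gt0// ltr_wpDl.
  have := sub w; rewrite -lerBDr -[_ - _ + _]addrA.
  suff : c * enorm (w - v) ^+ 2 <= e * enorm (w - v) by lra.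
  rewrite expr2 mulrA ler_wpM2r ?enorm_ge0//.
  have : enorm (w - v) * (c + 1) <= e by rewrite -ler_pdivlMr ?ltr_wpDl// ltW.
  by have := enorm_ge0 (w - v); nra.
set h := w - v; rewrite lerBlDr -lerBrDl.
apply/ler_addgt0Pr => e e0.
(* xi is tested along the segment [v, w], at a point close enough to v. *)
have e'0 : 0 < e / (enorm h + 1) by rewrite divr_gt0// ltr_wpDl ?enorm_ge0.
have [r r0 rP] := subdifferential_lower sub e'0.
pose t := Num.min 1 (r / (enorm h + 1) / 2).
have h1 : 0 < enorm h + 1 by rewrite ltr_wpDl ?enorm_ge0.
have t0 : 0 < t by rewrite lt_min ltr01/= !divr_gt0.
have t1 : t <= 1 by rewrite ge_min lexx.
have tr : t * enorm h < r.
  have : t <= r / (enorm h + 1) / 2 by rewrite ge_min lexx orbT.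
  rewrite ler_pdivlMr// ler_pdivlMr// => h2.
  by have := enorm_ge0 h; nra.
have := rP (v + t *: h); rewrite [v + _ - v]addrC addKr enormZ (gtr0_norm t0) => /(_ tr).
have := @semiconvex_segment t w v; rewrite (ltW t0) t1 => /(_ isT).
rewrite -/h dualityZr => seg low.
have eh : e / (enorm h + 1) * enorm h <= e.
  by rewrite mulrAC ler_pdivrMr// ler_pM2l// lerDl.
have : t * duality xi h <= t * (J w - J v + c * enorm h ^+ 2 + e).
  have : 0 <= c * (t * t * enorm h ^+ 2).
    by have tge0 := ltW t0; apply: mulr_ge0 => //; rewrite mulr_ge0 ?sqr_ge0// mulr_ge0.
  have : t * (e / (enorm h + 1) * enorm h) <= t * e by rewrite ler_pM2l.
  move: low seg; lra.
by rewrite ler_pM2l//; lra.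
Qed.

Lemma semiconvex_continuous (x : nat -> 'cV[R]_n) l :
  ecvg x l -> (J \o x) @ \oo --> J l.
Proof.
move=> xl; have cS := convex_fun_continuous cvxJ xl.
have cq : (fun k => c * enorm (x k) ^+ 2) @ \oo --> c * enorm l ^+ 2.
  by apply: cvgMl_tmp; exact: cvg_sqr_enorm.
have JE u : J u = J u + c * enorm u ^+ 2 - c * enorm u ^+ 2 by rewrite addrK.
by rewrite JE (funext (fun k => JE (x k) : (J \o x) k = _)); exact: cvgB.
Qed.

Lemma prox_subgradient_closed (x : nat -> 'cV[R]_n) (xi : nat -> 'rV[R]_n) v zeta :
  ecvg x v -> ecvg xi zeta -> (forall k, prox_subgradient J c (x k) (xi k)) ->
  prox_subgradient J c v zeta.
Proof.
move=> xv xz sub w.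
have dx : ecvg (fun k => w - x k) (w - v).
  by apply: ecvgD (ecvgN xv); exact: ecvg_cst.
have cl : (fun k => J (x k) + duality (xi k) (w - x k) - c * enorm (w - x k) ^+ 2)
    @ \oo --> J v + duality zeta (w - v) - c * enorm (w - v) ^+ 2.
  apply: cvgB; last by apply: cvgMl_tmp; exact: cvg_sqr_enorm.
  by apply: cvgD; [exact: semiconvex_continuous|exact: cvg_duality].
by apply: (cvgr_to_le cl); apply: nearW => k; exact: sub.
Qed.

End Semiconvex.
End ConvexAnalysis.

(** * Lagrange multipliers for the constrained proximal problem *)

Lemma bounded_ecvg_pair (R : realType) (p q r s : nat) (x : nat -> 'M[R]_(p, q))
    (y : nat -> 'M[R]_(r, s)) (M N : R) :
  (forall k, enorm (x k) <= M) -> (forall k, enorm (y k) <= N) ->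
  exists (K : nat -> nat) (l : 'M[R]_(p, q)) (l' : 'M[R]_(r, s)),
    [/\ forall j, (j <= K j)%N, ecvg (fun j => x (K j)) l
      & ecvg (fun j => y (K j)) l'].
Proof.
move=> xM yN.
have [K [l [jK xl]]] := bounded_ecvg_index
  (fun k i j => le_trans (entry_le_enorm (x k) i j) (xM k)).
have [L [l' [jL yl]]] := bounded_ecvg_index
  (fun k i j => le_trans (entry_le_enorm (y (K k)) i j) (yN (K k))).
exists (fun j => K (L j)), l, l'; split => //.
  by move=> j; exact: leq_trans (jL j) (jK _).
exact: (ecvg_subseq (x := fun k => x (K k))).
Qed.

Lemma continuous_coercive_min (R : realType) (n : nat) (G : 'cV[R]_n -> R) :
  (forall x l, ecvg x l -> (G \o x) @ \oo --> G l) -> (forall v, 0 <= G v) ->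
  coercive G -> exists v, forall w, G v <= G w.
Proof.
move=> cG G0 coG.
have infG : has_inf (range G).
  by split; [exists (G 0); exists 0|exists 0 => _ [v _ <-]].
have /boolp.choice[x xP] : forall k : nat, exists v, G v < inf (range G) + k.+1%:R^-1.
  move=> k; have k0 : 0 < k.+1%:R^-1 :> R by rewrite invr_gt0.
  by have [_ [v _ <-] ?] := inf_adherent k0 infG; exists v.
have [M hM] := coG (inf (range G) + 1).
have xM k i j : `|x k i j| <= M.
  apply: (le_trans (entry_le_enorm _ _ _)); apply: hM.
  by apply: (le_trans (ltW (xP k))); rewrite lerD2l invf_le1// ler1n.
have [K [l [jK xl]]] := bounded_ecvg_index xM.
exists l => w; apply: (@le_trans _ _ (inf (range G))); last first.
  by apply: ge_inf; [exact: infG.2|exists w].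
rewrite -[inf _]addr0.
have cinf : (fun j => inf (range G) + (K j).+1%:R^-1) @ \oo --> inf (range G) + 0.
  apply: cvgD; first exact: cvg_cst.
  by exact: (cvg_index (u := @harmonic R) jK (@cvg_harmonic R)).
apply: (ler_cvg_to (cG _ _ xl) cinf).
by apply: nearW => j; exact: ltW (xP _).
Qed.

Section Prox.
Context {R : realType} {m n : nat}.
Variables (A : 'M[R]_(m, n)) (J : 'cV[R]_n -> R) (eta : R).
Hypothesis A_surj : forall g : 'cV[R]_m, exists v : 'cV[R]_n, A *m v = g.
Hypothesis J_ge0 : forall v, 0 <= J v.
Hypothesis eta_gt0 : 0 < eta.
Hypothesis J2 : assumption_J2 J eta.
Hypothesis J3 : assumption_J3 J.

(** The estimate |A^* q| >= gamma |q|, from a right inverse of A. *)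
Lemma multiplier_bound : exists2 c : R, 0 <= c & forall q : 'rV[R]_m,
  enorm q <= c * enorm (q *m A).
Proof.
have [B AB] := right_inverse_of_surjective A_surj.
exists (1 * (m%:R * (n%:R * enorm B))) => [|q].
  by rewrite !mulr_ge0// enorm_ge0.
rewrite (_ : _ * _ = 1%:R * (m%:R * (n%:R * (enorm (q *m A) * enorm B)))); last by ring.
apply: enorm_bounded => i j.
have -> : q i j = ((q *m A) *m B) i j by rewrite -mulmxA AB mulmx1.
rewrite (ord1 i) mxE; apply: (le_trans (ler_norm_sum _ _ _)).
apply: (@le_trans _ _ (\sum_(k < n) enorm (q *m A) * enorm B)).
  by apply: ler_sum => k _; rewrite normrM ler_pM// entry_le_enorm.
by rewrite sumr_const card_ord -[leLHS]mulr_natl.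
Qed.

Lemma J2_convex : convex_fun (fun v => J v + eta * enorm v ^+ 2).
Proof. by apply: convex_function_setT; have [] := J2. Qed.

Lemma subdifferential_J v xi : subdifferential J v xi <-> prox_subgradient J eta v xi.
Proof. by apply: subdifferentialP J2_convex _ _; exact: ltW. Qed.

Lemma perturbed_convex vbar : convex_fun (perturbed J eta vbar).
Proof.
move=> t u v t01; have := J2_convex u v t01; rewrite /perturbed.
have e (w : 'cV[R]_n) : enorm (w - vbar) ^+ 2 =
    enorm w ^+ 2 - 2 * duality vbar^T w + enorm vbar ^+ 2.
  by rewrite sqr_enormB (duality_trC w).
rewrite !e dualityDr dualityZr dualityDr dualityNr.
by lra.
Qed.

Lemma perturbed_convex0 vbar :
  convex_fun (fun v => perturbed J eta vbar v + 0 * enorm v ^+ 2).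
Proof. by move=> t u v t01; rewrite !mul0r !addr0; exact: perturbed_convex. Qed.

(** The linear term 2 eta (v - vbar) is the gradient of the perturbation at v. *)
Lemma perturbed_expand vbar v w :
  perturbed J eta vbar w = J w + eta * enorm (w - v) ^+ 2
    + duality (2 * eta *: (v - vbar)^T) (w - v) + eta * enorm (v - vbar) ^+ 2.
Proof.
rewrite /perturbed; have -> : w - vbar = (w - v) + (v - vbar) by rewrite addrA subrK.
by rewrite [in LHS]sqr_enormD dualityZl duality_trC; ring.
Qed.

Lemma prox_subgradient_perturbed vbar v xi :
  prox_subgradient (perturbed J eta vbar) 0 v xi <->
  prox_subgradient J eta v (xi - 2 * eta *: (v - vbar)^T).
Proof.
split=> sub w; have := sub w.
  rewrite (perturbed_expand _ v w) [in X in X -> _]/perturbed dualityDl dualityNl mul0r.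
  by lra.
rewrite (perturbed_expand _ v w) [in X in _ -> X]/perturbed dualityDl dualityNl mul0r.
by lra.
Qed.

Lemma subdifferential_perturbed vbar v xi :
  subdifferential (perturbed J eta vbar) v xi <->
  prox_subgradient J eta v (xi - 2 * eta *: (v - vbar)^T).
Proof.
by rewrite -prox_subgradient_perturbed; apply: subdifferentialP (perturbed_convex0 vbar) _ _.
Qed.

Lemma J_continuous (x : nat -> 'cV[R]_n) l : ecvg x l -> (J \o x) @ \oo --> J l.
Proof. by have := @semiconvex_continuous _ _ J eta J2_convex x l; apply. Qed.

Lemma subgradient_multiplier_bound : exists2 C : R, 0 <= C &
  forall v (q : 'rV[R]_m) (u : 'rV[R]_n), prox_subgradient J eta v (q *m A - u) ->
    enorm q <= C * (J v + 1 + enorm u).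
Proof.
have [c c0 cP] := multiplier_bound; have [L L0 LP] := J3.
exists (c * (n%:R * (L + 1))) => [|v q u /subdifferential_J/LP sub].
  by rewrite !mulr_ge0// addr_ge0// ltW.
apply: (le_trans (cP q)); rewrite -!mulrA ler_wpM2l//.
rewrite -[q *m A](subrK u); apply: (le_trans (enormD_le _ _)).
rewrite mul1r ler_wpM2l//.
by have := J_ge0 v; have := enorm_ge0 u; nra.
Qed.

Lemma penalized_min vbar g (k : nat) : exists w, forall w',
  perturbed J eta vbar w + k.+1%:R * enorm (A *m w - g) ^+ 2 <=
  perturbed J eta vbar w' + k.+1%:R * enorm (A *m w' - g) ^+ 2.
Proof.
apply: continuous_coercive_min => [x l xl|v|c].
- apply: cvgD.
    apply: cvgD; first exact: J_continuous.
    apply: cvgMl_tmp; apply: cvg_sqr_enorm.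
    by apply: ecvgD => //; exact: ecvg_cst.
  apply: cvgMl_tmp; apply: cvg_sqr_enorm.
  apply: ecvgD; last exact: ecvg_cst.
  by apply: ecvgM => //; exact: ecvg_cst.
- by rewrite !addr_ge0// mulr_ge0 ?sqr_ge0// ltW.
- exists (n%:R * (1 * (1 + c / eta + enorm vbar))) => v vc.
  rewrite -[v](subrK vbar); apply: (le_trans (enormD_le _ _)).
  rewrite !ler_wpM2l// lerD2r.
  have : eta * enorm (v - vbar) ^+ 2 <= c.
    apply: le_trans vc; rewrite /perturbed -addrA addrCA lerDl.
    by rewrite addr_ge0// mulr_ge0// sqr_ge0.
  rewrite mulrC -ler_pdivlMr// => h.
  by have := enorm_ge0 (v - vbar); nra.
Qed.

(** The first-order condition: the penalty c |A w - g|^2 contributes the gradient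
2 c A^* (A w - g), which lies in the range of A^*. *)
Lemma penalized_subgradient vbar g (c : R) w :
  (forall w', perturbed J eta vbar w + c * enorm (A *m w - g) ^+ 2 <=
    perturbed J eta vbar w' + c * enorm (A *m w' - g) ^+ 2) ->
  prox_subgradient J eta w
    ((- (2 * c)) *: (A *m w - g)^T *m A - 2 * eta *: (w - vbar)^T).
Proof.
move=> minw; apply/prox_subgradient_perturbed => w'; rewrite mul0r subr0.
set h := w' - w; set P := perturbed J eta vbar.
rewrite duality_adj dualityZl.
set D := P w' - P w + 2 * c * duality (A *m w - g)^T (A *m h).
have Dt (t : R) : 0 < t <= 1 -> 0 <= D + t * (c * enorm (A *m h) ^+ 2).
  move=> /andP[t0 t1]; have := minw (w + t *: h).
  have := @perturbed_convex vbar t w' w; rewrite (ltW t0) t1 => /(_ isT).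
  have -> : A *m (w + t *: h) - g = (A *m w - g) + t *: (A *m h).
    by rewrite mulmxDr -scalemxAr addrAC.
  rewrite (sqr_enormD (A *m w - g) (t *: _)) sqr_enormZ dualityZr -/h -/P.
  move=> cP mw; have : 0 <= t * (D + t * (c * enorm (A *m h) ^+ 2)).
    by rewrite /D; lra.
  by rewrite pmulr_rge0.
suff : 0 <= D by rewrite /D; lra.
apply/ler_addgt0Pr => e e0; set Q := c * enorm (A *m h) ^+ 2 in Dt.
have Q1 : 0 < `|Q| + 1 by rewrite ltr_wpDl.
pose t := Num.min 1 (e / (`|Q| + 1)).
have t0 : 0 < t by rewrite lt_min ltr01/= divr_gt0.
have te : t * Q <= e.
  apply: (le_trans (ler_wpM2l (ltW t0) (ler_norm Q))).
  have : t <= e / (`|Q| + 1) by rewrite ge_min lexx orbT.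
  by rewrite ler_pdivlMr// => h1; nra.
have := Dt t; rewrite t0 ge_min lexx => /(_ isT); lra.
Qed.

(** Replacing the constraint A w = g by a penalty (k + 1) |A w - g|^2 produces
multipliers without a separation theorem.  A feasible point bounds the
penalized energies by a constant independent of k, hence the minimizers, the
values of J and, by (J3), the multipliers; a cluster point of the minimizers
and multipliers is the required pair. *)
Lemma prox_step_exists vbar g : exists w (q : 'rV[R]_m),
  A *m w = g /\ prox_subgradient J eta w (q *m A - 2 * eta *: (w - vbar)^T).
Proof.
have /boolp.choice[x xP] := penalized_min vbar g.
pose y k := (- (2 * k.+1%:R)) *: (A *m x k - g)^T.
have sub k := penalized_subgradient (xP k).
have [ws wsg] := A_surj g; set c0 := perturbed J eta vbar ws.
have bd k : perturbed J eta vbar (x k) + k.+1%:R * enorm (A *m x k - g) ^+ 2 <= c0.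
  by have := xP k ws; rewrite wsg subrr enorm0 expr0n mulr0 addr0.
have sq0 k : 0 <= k.+1%:R * enorm (A *m x k - g) ^+ 2 by rewrite mulr_ge0// sqr_ge0.
have eq0 k : 0 <= eta * enorm (x k - vbar) ^+ 2 by rewrite mulr_ge0 ?sqr_ge0// ltW.
have Jc k : J (x k) <= c0.
  by have := bd k; have := sq0 k; have := eq0 k; rewrite /perturbed; lra.
have dx k : enorm (x k - vbar) <= 1 + c0 / eta.
  have : enorm (x k - vbar) ^+ 2 <= c0 / eta.
    rewrite ler_pdivlMr// mulrC; have := bd k; have := sq0 k; have := J_ge0 (x k).
    by rewrite /perturbed; lra.
  by have := enorm_ge0 (x k - vbar); nra.
have xM k : enorm (x k) <= n%:R * (1 * (1 + c0 / eta + enorm vbar)).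
  rewrite -[x k](subrK vbar); apply: (le_trans (enormD_le _ _)).
  by rewrite !ler_wpM2l// lerD2r.
have [C C0 CP] := subgradient_multiplier_bound.
have yN k : enorm (y k) <= C * (c0 + 1 + 2 * eta * (1 + c0 / eta)).
  apply: (le_trans (CP _ _ _ (sub k))); rewrite ler_wpM2l// lerD ?lerD2r//.
  have e2 : 0 <= 2 * eta by rewrite mulr_ge0// ltW.
  by rewrite enormZ enorm_tr ger0_norm// ler_wpM2l.
have [K [w [q [jK xw yq]]]] := bounded_ecvg_pair xM yN.
exists w, q; split.
  have cA : ecvg (fun j => A *m x (K j) - g) (A *m w - g).
    apply: ecvgD; last exact: ecvg_cst.
    by apply: ecvgM => //; exact: ecvg_cst.
  have cH : (fun j => c0 * (K j).+1%:R^-1) @ \oo --> c0 * 0.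
    by apply: cvgMl_tmp; exact: (cvg_index (u := @harmonic R) jK (@cvg_harmonic R)).
  apply/eqP; rewrite -subr_eq0; apply/eqP/enorm_eq0/eqP.
  rewrite -[_ == _](@expf_eq0 _ _ 2) eq_le sqr_ge0 andbT -(mulr0 c0).
  apply: (ler_cvg_to (cvg_sqr_enorm cA) cH); apply: nearW => j.
  rewrite ler_pdivlMr// mulrC; have := bd (K j).
  have := J_ge0 (x (K j)); have := eq0 (K j); rewrite /perturbed; lra.
apply: (prox_subgradient_closed J2_convex (x := fun j => x (K j))
  (xi := fun j => y (K j) *m A - 2 * eta *: (x (K j) - vbar)^T)) => //.
apply: ecvgD; first by apply: ecvgM => //; exact: ecvg_cst.
apply/ecvgN/ecvgZ/ecvgT; apply: ecvgD => //; exact: ecvg_cst.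
Qed.

End Prox.

(** * From one critical point to the next *)

Lemma cvg_sqr0 (R : realType) (u : nat -> R) :
  (forall k, 0 <= u k) -> (fun k => u k ^+ 2) @ \oo --> 0 -> u @ \oo --> 0.
Proof.
move=> u0 /cvgr0_norm_le su; apply/cvgr0Pnorm_le => e e0.
have := su (e ^+ 2); rewrite exprn_gt0// => /(_ isT); apply: filterS => k.
by rewrite !ger0_norm ?sqr_ge0// ler_pXn2r ?nnegrE ?(ltW e0).
Qed.

Section Step.
Context {R : realType} {m n : nat}.
Variables (A : 'M[R]_(m, n)) (J : 'cV[R]_n -> R) (eta : R).
Hypothesis A_surj : forall g : 'cV[R]_m, exists v : 'cV[R]_n, A *m v = g.
Hypothesis J_ge0 : forall v, 0 <= J v.
Hypothesis eta_gt0 : 0 < eta.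
Hypothesis J1 : assumption_J1 J A.
Hypothesis J2 : assumption_J2 J eta.
Hypothesis J3 : assumption_J3 J.
Hypothesis J4 : assumption_J4 J A eta.

(** The subgradient inequality at w, tested at v: the proximal term contributes
2 eta |w - v|^2 and the quadratic defect takes half of it away. *)
Lemma prox_decrease (w v : 'cV[R]_n) (q : 'rV[R]_m) :
  prox_subgradient J eta w (q *m A - 2 * eta *: (w - v)^T) ->
  J w + eta * enorm (w - v) ^+ 2 <= J v + duality q (A *m w - A *m v).
Proof.
move=> /(_ v); rewrite -(opprB w v) enormN dualityNr dualityDl dualityNl dualityZl.
rewrite duality_adj -sqr_enorm_duality mulmxBr; lra.
Qed.

(** With d = |w - v| and h = |A w - A v|, strong convexity and (J4) give
nu d^2 <= <q' - q, A w - A v> <= C d h, hence d <= (C / nu) h and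
<q' - q, A w - A v> <= (C^2 / nu) h^2: q' may be replaced by q in the energy
estimate at the price of a quadratic error. *)
Lemma first_prox_step_energy : exists2 C : R, 0 <= C &
  forall v (q : 'rV[R]_m) w (q' : 'rV[R]_m),
    prox_subgradient J eta v (q *m A) ->
    prox_subgradient J eta w (q' *m A - 2 * eta *: (w - v)^T) ->
    J w <= J v + duality q (A *m w - A *m v) + C * enorm (A *m w - A *m v) ^+ 2.
Proof.
have [C C0 CP] := J4; have [_ [nu nu0 nuP]] := J2.
exists (C ^+ 2 / nu) => [|v q w q' sv sw]; first by rewrite divr_ge0 ?sqr_ge0// ltW.
have J4vw : duality (q' - q) (A *m w - A *m v) <=
    C * enorm (w - v) * enorm (A *m w - A *m v).
  apply: (CP v); apply/(subdifferential_perturbed J2) => //.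
  by rewrite subrr trmx0 scaler0 subr0.
have sub u xi : prox_subgradient J eta u (xi - 2 * eta *: (u - v)^T) ->
    subdifferential (fun v => J v + eta * enorm v ^+ 2) u (xi + 2 * eta *: v^T).
  move=> su; have -> : (fun v => J v + eta * enorm v ^+ 2) = perturbed J eta 0.
    by apply/funext => z; rewrite /perturbed subr0.
  apply/(subdifferential_perturbed J2); rewrite subr0.
  by move: su; rewrite linearB/= scalerBr opprB addrA addrAC.
have sv' : prox_subgradient J eta v (q *m A - 2 * eta *: (v - v)^T).
  by rewrite subrr trmx0 scaler0 subr0.
have := nuP _ _ _ _ (sub _ _ sw) (sub _ _ sv').
rewrite opprD addrACA subrr addr0 -mulmxBl duality_adj mulmxBr => strong.
have := prox_decrease sw; set h := enorm (A *m w - A *m v) in J4vw *.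
set d := enorm (w - v) in J4vw strong *.
have d0 : 0 <= d := enorm_ge0 _; have h0 : 0 <= h := enorm_ge0 _.
have nud : nu * d <= C * h.
  have [d1|d1] := ltP 0 d; last by rewrite (le_trans (_ : _ <= 0))// ?mulr_ge0 ?mulr_ge0_le0// ltW.
  by rewrite -(ler_pM2r d1); move: strong J4vw; lra.
have Cdh : C * d * h <= C ^+ 2 / nu * h ^+ 2.
  rewrite [leRHS]mulrAC ler_pdivlMr//.
  have : C * h * (nu * d) <= C * h * (C * h) by rewrite ler_wpM2l// mulr_ge0// ltW.
  lra.
have : 0 <= eta * d ^+ 2 by rewrite mulr_ge0 ?sqr_ge0// ltW.
move: J4vw; rewrite dualityDl dualityNl; lra.
Qed.

(** J decreases by eta |x_(k+1) - x_k|^2 at each step, so the increments tend to 0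
and the term 2 eta (x_(k+1) - x_k) disappears from the optimality condition. *)
Lemma prox_iteration_limit (w1 : 'cV[R]_n) : exists w (q : 'rV[R]_m),
  [/\ A *m w = A *m w1, prox_subgradient J eta w (q *m A) & J w <= J w1].
Proof.
have /boolp.choice[F FP] : forall v, exists wq : 'cV[R]_n * 'rV[R]_m,
    A *m wq.1 = A *m w1 /\
    prox_subgradient J eta wq.1 (wq.2 *m A - 2 * eta *: (wq.1 - v)^T).
  move=> v; have [w [q [? ?]]] := prox_step_exists A_surj J_ge0 eta_gt0 J2 J3 v (A *m w1).
  by exists (w, q).
pose x := fix x k := if k is k'.+1 then (F (x k')).1 else w1.
pose p k := (F (x k)).2.
have Ax k : A *m x k = A *m w1 by case: k => //= k; have [] := FP (x k).
have sub k : prox_subgradient J eta (x k.+1) (p k *m A - 2 * eta *: (x k.+1 - x k)^T).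
  by have [] := FP (x k).
have dec k : J (x k.+1) + eta * enorm (x k.+1 - x k) ^+ 2 <= J (x k).
  have := prox_decrease (sub k); rewrite !Ax subrr.
  by rewrite {1}/duality mulmx0 mxE addr0.
have eq0 k : 0 <= eta * enorm (x k.+1 - x k) ^+ 2 by rewrite mulr_ge0 ?sqr_ge0// ltW.
have Jdec : nonincreasing_seq (J \o x).
  apply/nonincreasing_seqP => k /=; have := dec k; have := eq0 k.
  by rewrite /=; lra.
have JM k : J (x k) <= J w1 by exact: (Jdec 0%N k).
have /cvg_ex[l Jl] : cvgn (J \o x).
  by apply: nonincreasing_is_cvgn => //; exists 0 => _ [k _ <-]; exact: J_ge0.
have d0 : ecvg (fun k => x k.+1 - x k) 0.
  apply/ecvg0_enorm/cvg_sqr0 => [k|]; first exact: enorm_ge0.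
  apply: (@squeeze_cvgr _ _ _ _ (fun=> 0) (fun k => eta^-1 * (J (x k) - J (x k.+1)))).
  - apply: nearW => k; rewrite sqr_ge0/= -ler_pdivrMl ?invr_gt0// invrK.
    by have := dec k; lra.
  - exact: cvg_cst.
  - rewrite -[X in _ --> X](mulr0 eta^-1) -[X in _ * X](subrr l).
    apply: cvgMl_tmp; apply: cvgB => //.
    exact: (cvg_index (u := J \o x) (L := succn)).
have [M xM] := J1 (J w1 + enorm (A *m w1) ^+ 2).
have {}xM k : enorm (x k.+1) <= M by apply: xM; rewrite Ax lerD2r.
have [C C0 CP] := subgradient_multiplier_bound A_surj J_ge0 eta_gt0 J2 J3.
have pM k : enorm (p k) <= C * (J w1 + 1 + 2 * eta * (1 + J w1 / eta)).
  apply: (le_trans (CP _ _ _ (sub k))); rewrite ler_wpM2l// lerD ?lerD2r//.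
  have e2 : 0 <= 2 * eta by rewrite mulr_ge0// ltW.
  rewrite enormZ enorm_tr ger0_norm// ler_wpM2l//.
  have : enorm (x k.+1 - x k) ^+ 2 <= J w1 / eta.
    rewrite ler_pdivlMr// mulrC; have := dec k; have := J_ge0 (x k.+1); have := JM k.
    by rewrite /=; lra.
  by have := enorm_ge0 (x k.+1 - x k); nra.
have [K [w [q [jK xw pq]]]] := bounded_ecvg_pair xM pM.
exists w, q; split.
- have cA : ecvg (fun j => A *m x (K j).+1) (A *m w).
    by apply: ecvgM => //; exact: ecvg_cst.
  apply: (ecvg_unique cA); rewrite (funext (fun j => Ax (K j).+1)).
  exact: ecvg_cst.
- have := prox_subgradient_closed (J2_convex J2) (x := fun j => x (K j).+1)
    (xi := fun j => p (K j) *m A - 2 * eta *: (x (K j).+1 - x (K j))^T)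
    (zeta := q *m A - 2 * eta *: 0^T) xw.
  rewrite trmx0 scaler0 subr0; apply => [|j]; last exact: sub.
  rewrite -[X in ecvg _ X]subr0 -(scaler0 _ (2 * eta)) -trmx0.
  apply: ecvgD; first by apply: ecvgM => //; exact: ecvg_cst.
  apply/ecvgN/ecvgZ/ecvgT.
  exact: (ecvg_subseq (x := fun k => x k.+1 - x k)).
- apply: (cvgr_to_le (J_continuous J2 xw)); apply: nearW => j; exact: JM.
Qed.

Lemma critical_step : exists2 C : R, 0 <= C &
  forall v (q : 'rV[R]_m) (g : 'cV[R]_m), prox_subgradient J eta v (q *m A) ->
    exists w (q' : 'rV[R]_m), [/\ A *m w = g, prox_subgradient J eta w (q' *m A)
      & J w <= J v + duality q (g - A *m v) + C * enorm (g - A *m v) ^+ 2].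
Proof.
have [C C0 CP] := first_prox_step_energy; exists C => // v q g sv.
have [w1 [q1 [Aw1 sw1]]] := prox_step_exists A_surj J_ge0 eta_gt0 J2 J3 v g.
have [w [q' [Aw sw Jw]]] := prox_iteration_limit w1.
exists w, q'; split => //; first by rewrite Aw.
by have := CP v q w1 q1 sv sw1; rewrite Aw1; exact: le_trans Jw.
Qed.

End Step.

(** * A C^1 ramp and its bump derivative *)

Section Ramp.
Context {R : realType}.
Implicit Types (x y a h : R).

Definition pospart x : R := Num.max 0 x.

Lemma pospart_ge0 x : 0 <= pospart x.
Proof. by rewrite le_max lexx. Qed.

Lemma pospart_id x : 0 <= x -> pospart x = x.
Proof. by move=> x0; rewrite /pospart; apply/max_idPr. Qed.

Lemma pospart_eq0 x : x <= 0 -> pospart x = 0.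
Proof. by move=> x0; rewrite /pospart; apply/max_idPl. Qed.

(** The difference quotient with increment h differs from 2 max(0, x) by at most
|h|. *)
Lemma is_derive_sqr_pospart x :
  is_derive x 1 (fun y => pospart y ^+ 2) (2 * pospart x).
Proof.
have cv : (fun h => h^-1 *: (((fun y => pospart y ^+ 2) \o shift x) (h *: 1) -
    pospart x ^+ 2)) @ 0^' --> 2 * pospart x.
  apply/subr_cvg0/norm_cvg0P.
  apply: (@squeeze_cvgr _ _ _ _ (fun=> 0) (fun h => `|h|)).
  - near=> h; rewrite normr_ge0/=.
    have h0 : h != 0 by near: h; exact: nbhs_dnbhs_neq.
    rewrite -(ler_pM2l (_ : 0 < `|h|)) ?normr_gt0// -normrM mulrBr.
    have sc (Y : R) : h * (h^-1 *: (Y : R^o)) = Y.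
      by rewrite -[h^-1 *: _]/(h^-1 * Y) mulVKf.
    rewrite [h *: 1]mulr1 sc /= -normrM -expr2 ger0_norm ?sqr_ge0//.
    have := pospart_ge0 x; have := pospart_ge0 (h + x); rewrite ler_norml /pospart.
    by case: (leP 0 x) => hx; case: (leP 0 (h + x)) => hhx _ _; apply/andP; split; nra.
  - exact: cvg_cst.
  - rewrite -[X in _ --> X](normr0 R); apply: cvg_norm.
    by apply: cvg_within; exact: cvg_id.
by apply: DeriveDef; [apply/cvg_ex; eexists; exact: cv|exact: cvg_lim cv].
Unshelve. all: by end_near. Qed.

Lemma continuous_pospart : continuous pospart.
Proof.
move=> x; rewrite /pospart; apply: continuous_max; [exact: cvg_cst|exact: cvg_id].
Qed.

Lemma is_derive_second_difference (f0 f1 f2 : R -> R) x (d0 d1 d2 : R) :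
  is_derive x 1 f0 d0 -> is_derive x 1 f1 d1 -> is_derive x 1 f2 d2 ->
  is_derive x 1 (fun z => 2^-1 * (f0 z - 2 * f1 z + f2 z)) (2^-1 * (d0 - 2 * d1 + d2)).
Proof.
move=> f0d f1d f2d.
have := is_deriveZ 2^-1 (is_deriveD (is_deriveB f0d (is_deriveZ 2 f1d)) f2d).
exact.
Qed.

(** The second difference of x |-> max(0, x): a bump of mass 1 on [0, 2]. *)
Definition tent y := pospart y - 2 * pospart (y - 1) + pospart (y - 2).

(** Half the second difference of x |-> max(0, x)^2, a primitive of the bump
[tent] that climbs from 0 to 1 on [0, 2]. *)
Definition ramp y :=
  2^-1 * (pospart y ^+ 2 - 2 * pospart (y - 1) ^+ 2 + pospart (y - 2) ^+ 2).

Lemma ramp_eq0 y : y <= 0 -> ramp y = 0.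
Proof. by move=> y0; rewrite /ramp !pospart_eq0; lra. Qed.

Lemma ramp_eq1 y : 2 <= y -> ramp y = 1.
Proof. by move=> y0; rewrite /ramp !pospart_id; lra. Qed.

Lemma tent_ge0 y : 0 <= tent y.
Proof.
rewrite /tent /pospart.
by case: (leP 0 y); case: (leP 0 (y - 1)); case: (leP 0 (y - 2)); lra.
Qed.

Lemma tent_eq0 y : y <= 0 \/ 2 <= y -> tent y = 0.
Proof.
by case=> y0; rewrite /tent; [rewrite !pospart_eq0; lra|rewrite !pospart_id; lra].
Qed.

Lemma ramp_itv y : 0 <= ramp y <= 1.
Proof.
rewrite /ramp /pospart.
by case: (leP 0 y); case: (leP 0 (y - 1)); case: (leP 0 (y - 2)) => *;
  apply/andP; split; nra.
Qed.

Lemma is_derive_ramp y : is_derive y 1 ramp (tent y).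
Proof.
have sh c : is_derive y 1 (fun z => pospart (z - c) ^+ 2) (2 * pospart (y - c)).
  have := @is_derive1_comp R (fun y => pospart y ^+ 2) (fun z => z - c) y
    (2 * pospart (y - c)) 1 (is_derive_sqr_pospart _).
  rewrite mulr1; apply; rewrite -[X in is_derive _ _ _ X]subr0.
  by apply: is_deriveB.
have := is_derive_second_difference (is_derive_sqr_pospart y) (sh 1) (sh 2).
rewrite (_ : 2^-1 * _ = tent y); first exact.
by rewrite /tent; lra.
Qed.

Lemma continuous_tent : continuous tent.
Proof.
move=> y; rewrite /tent; apply: cvgD.
  apply: cvgB; first exact: continuous_pospart.
  apply: cvgMl_tmp; apply: (@continuous_comp _ _ _ (fun z : R => z - 1) pospart).
    by apply: cvgB; [exact: cvg_id|exact: cvg_cst].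
  exact: continuous_pospart.
apply: (@continuous_comp _ _ _ (fun z : R => z - 2) pospart).
  by apply: cvgB; [exact: cvg_id|exact: cvg_cst].
exact: continuous_pospart.
Qed.

(** The bump [tent] rescaled to [a, a + 2 h], with its mass kept equal to 1. *)
Definition mollifier a h x := h^-1 * tent ((x - a) / h).

Lemma mollifier_ge0 a h x : 0 < h -> 0 <= mollifier a h x.
Proof. by move=> h0; rewrite mulr_ge0 ?tent_ge0// invr_ge0 ltW. Qed.

Lemma mollifier_eq0 a h x : 0 < h -> x <= a \/ a + 2 * h <= x -> mollifier a h x = 0.
Proof.
move=> h0 xa; rewrite /mollifier tent_eq0 ?mulr0//.
case: xa => xa; [left|right].
  by rewrite pmulr_lle0 ?invr_gt0// subr_le0.
by rewrite ler_pdivlMr// lerBrDl.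
Qed.

Lemma continuous_mollifier a h : continuous (mollifier a h).
Proof.
move=> x; apply: cvgMl_tmp.
apply: (@continuous_comp _ _ _ (fun z : R => (z - a) / h) tent).
  by apply: cvgMr_tmp; apply: cvgB; [exact: cvg_id|exact: cvg_cst].
exact: continuous_tent.
Qed.

Lemma is_derive_ramp_scaled a h x :
  is_derive x 1 (fun z => ramp ((z - a) / h)) (mollifier a h x).
Proof.
have dh : is_derive x 1 (fun z => (z - a) / h) h^-1.
  have -> : (fun z => (z - a) / h) = h^-1 \*: (id - cst a).
    by apply/funext => z /=; rewrite mulrC.
  have := is_deriveZ h^-1 (is_deriveB (is_derive_id x 1) (is_derive_cst a x 1)).
  by rewrite subr0 /GRing.scale/= mulr1.
have := @is_derive1_comp _ ramp (fun z => (z - a) / h) x _ _ (is_derive_ramp _) dh.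
by rewrite mulrC; exact.
Qed.

Lemma integral_mollifier (T a h : R) : 0 < h -> 0 <= a -> a + 2 * h <= T ->
  (\int[lebesgue_measure]_(x in `[0%R, T]) (mollifier a h x)%:E = 1)%E.
Proof.
move=> h0 a0 aT.
have T0 : 0 < T by apply: lt_le_trans aT; rewrite ltr_wpDl// mulr_gt0.
have der x : derivable (fun z => ramp ((z - a) / h)) x 1.
  by have [] := is_derive_ramp_scaled a h x.
rewrite (@continuous_FTC2 _ (mollifier a h) (fun z => ramp ((z - a) / h)))//.
- rewrite ramp_eq1 ?ramp_eq0 ?sube0// ?ler_pdivlMr//.
    by rewrite pmulr_lle0 ?invr_gt0//; lra.
  by rewrite lerBrDl.
- by apply: continuous_subspaceT; exact: continuous_mollifier.
- have cR x : {for x, continuous (fun z => ramp ((z - a) / h))}.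
    by apply: differentiable_continuous; apply/derivable1_diffP.
  split => //.
  + by apply: cvg_at_right_filter; exact: cR.
  + by apply: cvg_at_left_filter; exact: cR.
- by move=> x _; rewrite derive1E; have [_ ->] := is_derive_ramp_scaled a h x.
Qed.

End Ramp.

(** * The fundamental theorem of calculus for weak derivatives *)

Section RintegralFacts.
Context d (X : measurableType d) {R : realType} (mu : {measure set X -> \bar R}).
Implicit Types (D : set X) (f g G : X -> R).

Lemma integrable_EFinB D f g : measurable D -> mu.-integrable D (EFin \o f) ->
  mu.-integrable D (EFin \o g) -> mu.-integrable D (EFin \o (fun t => f t - g t)).
Proof.
move=> mD fi gi; have := integrableB mD fi gi.
by apply: eq_integrable => // x _; rewrite /= EFinB.
Qed.

Lemma integrable_EFinZ D (r : R) f : measurable D -> mu.-integrable D (EFin \o f) ->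
  mu.-integrable D (EFin \o (fun t => r * f t)).
Proof.
move=> mD fi; have := integrableZl mD r fi.
by apply: eq_integrable => // x _; rewrite /= EFinM.
Qed.

Lemma dominated_Rintegral D (f_ : nat -> X -> R) f G : measurable D ->
  (forall k, measurable_fun D (f_ k)) ->
  (forall x, D x -> (fun k => f_ k x) @ \oo --> f x) ->
  mu.-integrable D (EFin \o G) -> (forall k x, D x -> `|f_ k x| <= G x) ->
  mu.-integrable D (EFin \o f) /\
  (fun k => \int[mu]_(x in D) f_ k x) @ \oo --> \int[mu]_(x in D) f x.
Proof.
move=> mD mf ff Gi fG.
have mf' : measurable_fun D f by exact: measurable_fun_cvg mf ff.
have [|||||fi _ cf] := @dominated_convergence _ X R mu _ mD
    (fun k => EFin \o f_ k) (EFin \o f) (EFin \o G).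
- by move=> k; exact/measurable_EFinP.
- exact/measurable_EFinP.
- by apply: aeW => x Dx; apply: cvg_EFin; [exact: nearW|exact: ff].
- by [].
- by apply: aeW => x k Dx; rewrite /= lee_fin fG.
split=> //; apply: fine_cvg; rewrite fineK; first exact: cf.
exact: integrable_fin_num.
Qed.

End RintegralFacts.

Lemma integrable_subitv {R : realType} (i j : interval R) (f : R -> \bar R) :
  [set` i] `<=` [set` j] ->
  (@lebesgue_measure R).-integrable [set` j] f -> lebesgue_measure.-integrable [set` i] f.
Proof.
move=> ij fi. apply: (integrableS _ _ _ fi) => //.
Qed.

Lemma Rintegral_itv_split {R : realType} (a b c : R) (f : R -> R) : a <= c -> c <= b ->
  lebesgue_measure.-integrable `[a, b] (EFin \o f) ->
  \int[lebesgue_measure]_(t in `[a, b]) f t =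
  \int[lebesgue_measure]_(t in `[a, c]) f t +
  \int[lebesgue_measure]_(t in `[c, b]) f t.
Proof.
move=> ac cb fi; have := @Rintegral_itvB _ _ _ _ c fi.
rewrite !bnd_simp ac cb => /(_ isT isT).
rewrite Rintegral_itv_obnd_cbnd; first by move/eqP; rewrite subr_eq addrC => /eqP.
by apply: integrableS fi => //; apply: subset_itvr; rewrite bnd_simp.
Qed.

Section WeakDerivative.
Context {R : realType}.
Local Notation mu := (@lebesgue_measure R).
Variables (T : R) (g dg : R -> R).

Hypothesis g_continuous : forall a : R, 0 <= a <= T -> forall e : R, 0 < e ->
  exists2 d : R, 0 < d & forall t : R, 0 <= t <= T -> `|t - a| < d -> `|g t - g a| <= e.
Hypothesis dg_integrable : mu.-integrable `[0, T] (EFin \o dg).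
Hypothesis dg_weak : forall phi, test_function T phi ->
  \int[mu]_(t in `[0, T]) (g t * derive1 phi t) =
  - \int[mu]_(t in `[0, T]) (dg t * phi t).

Lemma within_continuous_g : {within `[0, T], continuous g}.
Proof.
apply/subspace_continuousP => a /=; rewrite in_itv/= => a0T.
apply/cvgrPdist_le => e e0; have [d d0 dP] := g_continuous a0T e0.
rewrite near_withinE; apply/nbhs_ballP; exists d => //= t.
by rewrite /ball/= distrC in_itv/= => td t0T; rewrite distrC dP.
Qed.

Lemma integrable_mul_mollifier (c h : R) :
  mu.-integrable `[0, T] (EFin \o (fun t => g t * mollifier c h t)).
Proof.
apply: continuous_compact_integrable; first exact: segment_compact.
move=> t; apply: continuousM; first exact: within_continuous_g.
by have := continuous_subspaceT (A := `[0, T]) (@continuous_mollifier R c h); apply.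
Qed.

Lemma integrable_mollifier (c h : R) : mu.-integrable `[0, T] (EFin \o (mollifier c h)).
Proof.
apply: continuous_compact_integrable; first exact: segment_compact.
by apply: continuous_subspaceT; exact: continuous_mollifier.
Qed.

Lemma mollifier_approximation (c h x0 e : R) : 0 < h -> 0 <= c -> c + 2 * h <= T ->
  (forall t, c <= t <= c + 2 * h -> `|g t - g x0| <= e) ->
  `|\int[mu]_(t in `[0, T]) (g t * mollifier c h t) - g x0| <= e.
Proof.
move=> h0 c0 cT ge.
have int1 : \int[mu]_(t in `[0, T]) mollifier c h t = 1.
  by rewrite /Rintegral integral_mollifier.
have ic r : mu.-integrable `[0, T] (EFin \o (fun t => r * mollifier c h t)).
  by apply: integrable_EFinZ => //; exact: integrable_mollifier.
have -> : g x0 = \int[mu]_(t in `[0, T]) (g x0 * mollifier c h t).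
  by rewrite RintegralZl ?int1 ?mulr1//; exact: integrable_mollifier.
rewrite -RintegralB//; last exact: integrable_mul_mollifier.
have idiff : mu.-integrable `[0, T]
    (EFin \o (fun t => g t * mollifier c h t - g x0 * mollifier c h t)).
  by apply: integrable_EFinB => //; exact: integrable_mul_mollifier.
apply: (le_trans (le_normr_Rintegral _ idiff)) => //.
have -> : e = \int[mu]_(t in `[0, T]) (e * mollifier c h t).
  by rewrite RintegralZl ?int1 ?mulr1//; exact: integrable_mollifier.
apply: le_Rintegral => //.
  by have := integrable_norm idiff; exact.
move=> t _; rewrite -mulrBl normrM (ger0_norm (mollifier_ge0 _ _ h0)).
have [ct|/negP tc] := boolP (c <= t <= c + 2 * h).
  by rewrite ler_wpM2r ?mollifier_ge0// ge.
rewrite mollifier_eq0 ?mulr0//.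
by move/negP: tc; rewrite negb_and -!ltNge => /orP[/ltW|/ltW]; [left|right].
Qed.

(** The test function phi k rises from 0 to 1 just after a and falls back just
before b, so it is admissible even if a = 0 or b = T.  Its derivative is the
difference of two bumps of mass 1 concentrating at a and at b, so that the
integral of g phi' tends to g a - g b, while the integral of dg phi tends to
that of dg over ]a, b[ by dominated convergence. *)
Lemma weak_derivative_integral_lt (a b : R) : 0 <= a -> a < b -> b <= T ->
  \int[mu]_(t in `[a, b]) dg t = g b - g a.
Proof.
move=> a0 ab bT.
(* The bound h k <= (b - a) / 6 keeps the ramps [a + h, a + 3 h] and
   [b - 3 h, b - h] from overlapping. *)
pose h k : R := (b - a) / k.+1%:R / 6.
have h0 k : 0 < h k by rewrite !divr_gt0// subr_gt0.
have hba k : 6 * h k <= b - a.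
  rewrite mulrC divfK// ler_pdivrMr// ler_peMr ?subr_ge0 ?(ltW ab)//.
  by rewrite ler1n.
have ch : h @ \oo --> 0.
  rewrite /h -(mul0r 6^-1) -(mulr0 (b - a)); apply: cvgMr_tmp; apply: cvgMl_tmp.
  exact: cvg_harmonic.
pose phi k t := ramp ((t - (a + h k)) / h k) - ramp ((t - (b - 3 * h k)) / h k).
have dphi k (t : R) : is_derive t 1 (phi k)
    (mollifier (a + h k) (h k) t - mollifier (b - 3 * h k) (h k) t).
  have := is_deriveB (is_derive_ramp_scaled (a + h k) (h k) t)
    (is_derive_ramp_scaled (b - 3 * h k) (h k) t).
  exact.
have d1phi k : derive1 (phi k) =
    fun t => mollifier (a + h k) (h k) t - mollifier (b - 3 * h k) (h k) t.
  by apply/funext => t; rewrite derive1E; have [_ ->] := dphi k t.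
have phi0 k t : t <= a + h k \/ b - h k <= t -> phi k t = 0.
  have := hba k; have := h0 k; set hk := h k => hk0 hkb.
  case=> ta; rewrite /phi -/hk.
    by rewrite !ramp_eq0 ?subrr// pmulr_lle0 ?invr_gt0//; lra.
  by rewrite !ramp_eq1 ?subrr// ler_pdivlMr//; lra.
have phi1 k t : a + 3 * h k <= t -> t <= b - 3 * h k -> phi k t = 1.
  move=> ta tb; rewrite /phi ramp_eq1 ?ramp_eq0 ?subr0//.
    by rewrite pmulr_lle0 ?invr_gt0// subr_le0.
  by rewrite ler_pdivlMr//; lra.
have phi_le1 k t : `|phi k t| <= 1.
  have := ramp_itv ((t - (a + h k)) / h k).
  have := ramp_itv ((t - (b - 3 * h k)) / h k).
  by rewrite /phi ler_norml; lra.
have test k : test_function T (phi k).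
  have := hba k; have := h0 k => hk0 hkb; split.
  - by move=> t; have [] := dphi k t.
  - by rewrite d1phi => t; apply: cvgB; exact: continuous_mollifier.
  - exists (a + h k), (b - h k); split; [lra|lra|lra|move=> t].
    rewrite in_itv/= negb_and -!ltNge => tab; apply: phi0.
    by case/orP : tab => /ltW; [left|right].
have lhs : (fun k => \int[mu]_(t in `[0, T]) (g t * derive1 (phi k) t)) @ \oo
    --> g a - g b.
  apply/cvgrPdist_le => e e0.
  have e20 : 0 < e / 2 by rewrite divr_gt0.
  have a0T : 0 <= a <= T by lra.
  have b0T : 0 <= b <= T by lra.
  have [da da0 daP] := g_continuous a0T e20.
  have [db db0 dbP] := g_continuous b0T e20.
  have hd d : 0 < d -> \forall k \near \oo, 3 * h k < d.
    move=> d0; have d30 : 0 < d / 3 by rewrite divr_gt0.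
    move/cvgr0_norm_lt : ch => /(_ _ d30); apply: filterS => k.
    by rewrite (gtr0_norm (h0 k)) ltr_pdivlMr// mulrC.
  near=> k; have hka : 3 * h k < da by near: k; exact: hd.
  have hkb : 3 * h k < db by near: k; exact: hd.
  have := hba k; have := h0 k; set hk := h k in hka hkb * => hk0 hk6.
  rewrite d1phi -/hk; under eq_Rintegral do rewrite mulrBr.
  rewrite RintegralB//; [|exact: integrable_mul_mollifier..].
  have appa : `|\int[mu]_(t in `[0, T]) (g t * mollifier (a + hk) hk t) - g a| <= e / 2.
    apply: mollifier_approximation => //; [lra|lra|move=> t tk].
    by apply: daP; [lra|rewrite ltr_norml; lra].
  have appb : `|\int[mu]_(t in `[0, T]) (g t * mollifier (b - 3 * hk) hk t) - g b| <= e / 2.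
    apply: mollifier_approximation => //; [lra|lra|move=> t tk].
    by apply: dbP; [lra|rewrite ltr_norml; lra].
  by move: appa appb; rewrite !ler_norml; lra.
have mdg : measurable_fun `[0, T] dg.
  by apply/measurable_EFinP; exact: measurable_int dg_integrable.
have [k|t /=||k t _|_ rhs] := @dominated_Rintegral _ _ R mu `[0, T]
  (fun k t => dg t * phi k t) (dg \_ `]a, b[) (fun t => `|dg t|) (measurable_itv _).
- apply: measurable_funM => //.
  apply: measurable_funTS; apply: continuous_measurable_fun => t.
  apply: differentiable_continuous; apply/derivable1_diffP.
  by have [] := dphi k t.
- rewrite in_itv/= => t0T; rewrite /patch.
  case: ifPn => [|tab]; last first.
    rewrite (_ : (fun k => _) = fun=> 0); first exact: cvg_cst.
    apply/funext => k; rewrite phi0 ?mulr0//.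
    move: tab; rewrite notin_setE/= in_itv/= => /negP.
    by rewrite negb_and -!leNgt; have := h0 k; lra.
  rewrite inE/= in_itv/= => /andP[at_ tb].
  have at0 : 0 < (Num.min (t - a) (b - t)) / 3.
    by rewrite divr_gt0// lt_min !subr_gt0 at_.
  rewrite -[X in _ --> X]mulr1; apply: cvgMl_tmp.
  apply: (@cvg_trans _ ((fun=> 1) @ \oo)); last exact: cvg_cst.
  apply: near_eq_cvg; move/cvgr0_norm_lt : ch => /(_ _ at0).
  apply: filterS => k; rewrite (gtr0_norm (h0 k)) ltr_pdivlMr// lt_min => hk.
  by rewrite phi1//; lra.
- exact: integrable_norm.
- by rewrite normrM /= ler_piMr.
have := cvgN rhs.
rewrite (_ : - (fun k => _) = (fun k => \int[mu]_(t in `[0, T]) (g t * derive1 (phi k) t))).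
  move=> rhs'; have := cvg_unique (@Rhausdorff R) (rhs' _) lhs.
  rewrite -Rintegral_mkcondr (_ : `[0, T] `&` `]a, b[ = `]a, b[)%classic; last first.
    apply/setIidPr => t /=; rewrite !in_itv/= => /andP[? ?]; lra.
  rewrite Rintegral_itv_bndo_bndc.
    rewrite Rintegral_itv_obnd_cbnd.
      by move=> E; rewrite -[LHS]opprK; move: E => ->; rewrite opprB.
    by apply: integrable_subitv dg_integrable => t /=; rewrite !in_itv/= => /andP[? ?]; lra.
  by apply: integrable_subitv dg_integrable => t /=; rewrite !in_itv/= => /andP[? ?]; lra.
by apply/funext => k; rewrite dg_weak.
Unshelve. all: by end_near. Qed.

Theorem weak_derivative_integral (a b : R) : 0 <= a -> a <= b -> b <= T ->
  \int[mu]_(t in `[a, b]) dg t = g b - g a.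
Proof.
move=> a0; rewrite le_eqVlt => /predU1P[<- _|ab bT]; last exact: weak_derivative_integral_lt.
by rewrite subrr set_itv1 Rintegral_set1.
Qed.

End WeakDerivative.

(** * Estimates for the constraint *)

Section Sobolev.
Context {R : realType} {m : nat}.
Local Notation mu := (@lebesgue_measure R).
Variables (T : R) (f df : R -> 'cV[R]_m).

Hypothesis f_W12 : sobolev_W12 T f df.

Lemma sobolev_modulus (e : R) : 0 < e -> exists2 d : R, 0 < d &
  forall s t, 0 <= s -> s <= t -> t <= T -> t - s < d -> enorm (f t - f s) < e.
Proof.
have [ac _ _ _] := f_W12; move=> /ac[d d0 dP]; exists d => // s t s0 st tT std.
have := dP 1%N (fun=> s) (fun=> t); rewrite !big_ord1; apply => //.
by move=> i j; rewrite !ord1 eqxx.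
Qed.

(** On a bounded interval, |x| <= 1 + x^2 makes square integrable functions
integrable. *)
Lemma sobolev_derivative_integrable i : mu.-integrable `[0, T] (EFin \o (fun t => df t i 0)).
Proof.
have [_ _ [mdf idf2] _] := f_W12.
have i1 : mu.-integrable `[0, T] (EFin \o (cst 1 : R -> R)).
  apply: continuous_compact_integrable; first exact: segment_compact.
  by apply: continuous_subspaceT => t; exact: cvg_cst.
apply: le_integrable (integrableD _ i1 idf2) => //.
- by apply/measurable_EFinP; exact: mdf.
- move=> t _; rewrite -[leRHS]/(`|(1 + enorm (df t) ^+ 2)%:E|)%E lee_fin.
  rewrite [leRHS]ger0_norm ?addr_ge0 ?sqr_ge0//.
  have := entry_le_enorm (df t) i 0; have := enorm_ge0 (df t); set x := enorm _.
  by move=> x0 le1; nra.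
Qed.

Definition derivative_norm1 t : R := \sum_i `|df t i 0|.

Lemma derivative_norm1_ge0 t : 0 <= derivative_norm1 t.
Proof. exact: sumr_ge0. Qed.

Lemma derivative_norm1_integrable : mu.-integrable `[0, T] (EFin \o derivative_norm1).
Proof.
have : mu.-integrable `[0, T] (fun t => \sum_i `|df t i 0|%:E)%E.
  apply: integrable_sum => // i _.
  exact: (integrable_norm (sobolev_derivative_integrable i)).
by apply: eq_integrable => // t _; rewrite /= -sumEFin.
Qed.

Lemma sobolev_coord_continuous i (a : R) : 0 <= a <= T -> forall e : R, 0 < e ->
  exists2 d : R, 0 < d & forall t : R, 0 <= t <= T -> `|t - a| < d ->
    `|f t i 0 - f a i 0| <= e.
Proof.
move=> /andP[a0 aT] e /sobolev_modulus[d d0 dP]; exists d => // t /andP[t0 tT] ta.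
have [at_|ta_] := leP a t.
  have := entry_le_enorm (f t - f a) i 0; rewrite !mxE => /le_trans; apply.
  by apply/ltW/dP => //; apply: le_lt_trans ta; exact: ler_norm.
have := entry_le_enorm (f a - f t) i 0; rewrite !mxE distrC => /le_trans; apply.
apply/ltW/dP => //; first exact: ltW.
by rewrite -normrN opprB in ta; apply: le_lt_trans ta; exact: ler_norm.
Qed.

Lemma sobolev_FTC (a b : R) i : 0 <= a -> a <= b -> b <= T ->
  \int[mu]_(t in `[a, b]) df t i 0 = f b i 0 - f a i 0.
Proof.
have [_ _ _ weak] := f_W12.
apply: (@weak_derivative_integral _ T (fun t => f t i 0)).
- exact: sobolev_coord_continuous.
- exact: sobolev_derivative_integrable.
- by move=> phi tphi; exact: weak.
Qed.

Lemma sobolev_FTC_duality (a b : R) (q : 'rV[R]_m) : 0 <= a -> a <= b -> b <= T ->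
  \int[mu]_(t in `[a, b]) duality q (df t) = duality q (f b - f a).
Proof.
move=> a0 ab bT; rewrite dualityE.
have sub : `[a, b] `<=` `[0, T].
  by move=> t /=; rewrite !in_itv/= => /andP[? ?]; lra.
have ii i : mu.-integrable `[a, b] (EFin \o (fun t => df t i 0)).
  exact: integrable_subitv sub (sobolev_derivative_integrable i).
under eq_Rintegral do rewrite dualityE.
have : \int[mu]_(t in `[a, b]) (\sum_i q 0 i * df t i 0) =
    \sum_i \int[mu]_(t in `[a, b]) (q 0 i * df t i 0).
  elim: (index_enum _) => [|i r IH].
    by rewrite big_nil; under eq_Rintegral do rewrite big_nil; rewrite Rintegral_cst ?mul0r.
  rewrite big_cons -IH; under eq_Rintegral do rewrite big_cons.
  rewrite RintegralD//; first by apply: integrable_EFinZ.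
  have : mu.-integrable `[a, b] (fun t => \sum_(i <- r) (q 0 i * df t i 0)%:E)%E.
    by apply: integrable_sum => // j _; apply: integrable_EFinZ.
  by apply: eq_integrable => // t _; rewrite /= -sumEFin.
move=> ->; apply: eq_bigr => i _.
by rewrite RintegralZl// sobolev_FTC// !mxE.
Qed.

Lemma sobolev_increment_le (a b : R) : 0 <= a -> a <= b -> b <= T ->
  enorm (f b - f a) <= \int[mu]_(t in `[a, b]) derivative_norm1 t.
Proof.
move=> a0 ab bT; apply: (le_trans (enorm_le_sum _)).
have sub : `[a, b] `<=` `[0, T].
  by move=> t /=; rewrite !in_itv/= => /andP[? ?]; lra.
have ii i : mu.-integrable `[a, b] (EFin \o (fun t => df t i 0)).
  exact: integrable_subitv sub (sobolev_derivative_integrable i).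
rewrite /derivative_norm1.
elim: (index_enum _) => [|i r IH].
  by rewrite big_nil; apply: Rintegral_ge0 => t _; rewrite big_nil.
rewrite big_cons; under eq_Rintegral do rewrite big_cons.
rewrite RintegralD//; first last.
- have : mu.-integrable `[a, b] (fun t => \sum_(i <- r) `|df t i 0|%:E)%E.
    by apply: integrable_sum => // j _; exact: (integrable_norm (ii j)).
  by apply: eq_integrable => // t _; rewrite /= -sumEFin.
- exact: (integrable_norm (ii i)).
apply: lerD => //; rewrite big_ord1 !mxE -sobolev_FTC//.
exact: le_normr_Rintegral.
Qed.

Lemma sobolev_variation (a : nat -> R) (N : nat) :
  a 0%N = 0 -> (forall j, a j <= a j.+1) -> a N <= T ->
  \sum_(j < N) enorm (f (a j.+1) - f (a j)) <= \int[mu]_(t in `[0, T]) derivative_norm1 t.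
Proof.
move=> a00 amono aNT.
have age0 j : 0 <= a j.
  by elim: j => [|j IH]; [rewrite a00|exact: le_trans (amono j)].
have intS (b : R) : b <= T -> mu.-integrable `[0, b] (EFin \o derivative_norm1).
  move=> bT; apply: integrable_subitv derivative_norm1_integrable => t /=.
  by rewrite !in_itv/= => /andP[? ?]; lra.
have partial : \sum_(j < N) enorm (f (a j.+1) - f (a j)) <=
    \int[mu]_(t in `[0, a N]) derivative_norm1 t.
  elim: N aNT => [|N IH] aNT.
    by rewrite big_ord0; apply: Rintegral_ge0 => t _; exact: derivative_norm1_ge0.
  rewrite big_ord_recr/= (Rintegral_itv_split (age0 N) (amono N))//; last exact: intS.
  apply: lerD; first exact: IH (le_trans (amono N) aNT).
  exact: sobolev_increment_le.
apply: (le_trans partial); rewrite [leRHS](Rintegral_itv_split (age0 N) aNT)//; last exact: intS.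
by rewrite lerDl; apply: Rintegral_ge0 => t _; exact: derivative_norm1_ge0.
Qed.

Lemma normr_duality_derivative (q : 'rV[R]_m) t :
  `|duality q (df t)| <= enorm q * derivative_norm1 t.
Proof.
rewrite dualityE mulr_sumr; apply: (le_trans (ler_norm_sum _ _ _)).
by apply: ler_sum => i _; rewrite normrM ler_wpM2r// entry_le_enorm.
Qed.

Lemma measurable_duality_derivative (q : R -> 'rV[R]_m) :
  (forall j, measurable_fun (`[0, T] : set (measurableTypeR R)) (fun t => q t 0 j)) ->
  measurable_fun (`[0, T] : set (measurableTypeR R)) (fun t => duality (q t) (df t)).
Proof.
move=> mq; rewrite (_ : (fun t => _) = fun t => \sum_j q t 0 j * df t j 0); last first.
  by apply/funext => t; rewrite dualityE.
apply: measurable_sum => j; apply: measurable_funM => //.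
by have [_ _ [mdf _] _] := f_W12; exact: mdf.
Qed.

Lemma duality_derivative_integrable (q : R -> 'rV[R]_m) (M : R) :
  (forall j, measurable_fun (`[0, T] : set (measurableTypeR R)) (fun t => q t 0 j)) ->
  (forall t, 0 <= t <= T -> enorm (q t) <= M) ->
  mu.-integrable `[0, T] (EFin \o (fun t => duality (q t) (df t))).
Proof.
move=> mq qM.
apply: le_integrable (integrable_EFinZ M _ derivative_norm1_integrable) => //.
- by apply/measurable_EFinP; exact: measurable_duality_derivative.
- move=> t /=; rewrite in_itv/= => t0T; rewrite lee_fin.
  apply: (le_trans (normr_duality_derivative _ _)); apply: le_trans (ler_norm _).
  by rewrite ler_wpM2r ?derivative_norm1_ge0// qM.
Qed.

End Sobolev.

(** * Discrete evolutions *)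

Section Grid.
Context {R : realType}.
Implicit Types (t delta : R) (i : nat).

Definition grid_index delta t : nat := Num.truncn (t / delta).

Lemma grid_index_def delta t i : 0 < delta ->
  i%:R * delta <= t < i.+1%:R * delta -> grid_index delta t = i.
Proof.
move=> d0 it; apply: truncn_def.
by rewrite ler_pdivlMr// ltr_pdivrMr.
Qed.

Lemma grid_index_neg delta t : 0 < delta -> t < delta -> grid_index delta t = 0%N.
Proof.
move=> d0 td; apply/truncn0Pn; rewrite -ltNge.
by rewrite ltr_pdivrMr// mul1r.
Qed.

Lemma grid_index_itv delta t : 0 < delta -> 0 <= t ->
  (grid_index delta t)%:R * delta <= t < (grid_index delta t).+1%:R * delta.
Proof.
move=> d0 t0; have /truncn_itv : 0 <= t / delta by rewrite divr_ge0// ltW.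
by rewrite ler_pdivlMr// ltr_pdivrMr.
Qed.

Lemma grid_index_right delta t : 0 < delta ->
  \forall s \near t^'+, grid_index delta s = grid_index delta t.
Proof.
move=> d0; have [t0|t0] := leP 0 t.
  have /andP[it ti] := grid_index_itv d0 t0.
  near=> s; have ts : t < s by near: s; exact: nbhs_right_gt.
  apply: grid_index_def => //; rewrite (le_trans it (ltW ts))/=.
  by near: s; apply: nbhs_right_lt; exact: ti.
have td : t < delta by exact: lt_trans d0.
near=> s; rewrite !grid_index_neg//.
Unshelve. all: by end_near. Qed.

Lemma measurable_grid_index delta (D : set (measurableTypeR R)) : 0 < delta ->
  measurable D -> measurable_fun D (grid_index delta : measurableTypeR R -> nat).
Proof.
move=> d0 mD _ B _.
have le_meas k : measurable [set t : measurableTypeR R | (grid_index delta t <= k)%N].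
  rewrite (_ : [set t | _] = [set` `]-oo, k.+1%:R * delta[ ]); first exact: measurable_itv.
  by apply/seteqP; split => t /=; rewrite in_itv/= /grid_index truncn_le_nat ltr_pdivrMr.
rewrite (_ : _ @^-1` B = \bigcup_(k in B) [set t | grid_index delta t = k]); last first.
  by apply/seteqP; split => [t Bt|t [k Bk /= ->//]]; exists (grid_index delta t).
apply: measurableI => //; apply: bigcup_measurable => -[|k] _.
  rewrite (_ : [set t | _] = [set t | (grid_index delta t <= 0)%N])//.
  by apply/seteqP; split => t /=; rewrite leqn0 => /eqP.
rewrite (_ : [set t | _] = [set t | (grid_index delta t <= k.+1)%N] `\`
    [set t | (grid_index delta t <= k)%N]); first exact: measurableD.
apply/seteqP; split => t /=; first by move=> ->; rewrite leqnn ltnn.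
by move=> [le1 /negP]; rewrite -ltnNge => lt1; apply/eqP; rewrite eqn_leq le1.
Qed.

Lemma measurable_grid_step delta (D : set (measurableTypeR R)) (g : nat -> R) :
  0 < delta -> measurable D ->
  measurable_fun D (fun t : measurableTypeR R => g (grid_index delta t)).
Proof.
move=> d0 mD; apply: (@measurable_fun_index _ _ D mD _ _ (fun k _ => g k)).
  exact: measurable_grid_index.
by move=> k; exact: measurable_cst.
Qed.

End Grid.

(** 1 + x <= exp x turns the product of the factors into the exponential of a sum. *)
Lemma discrete_gronwall (R : realType) (u a : nat -> R) (b : R) (N : nat) :
  (forall i, 0 <= u i) -> 0 <= b -> (forall i, 0 <= a i) ->
  (forall i, (i < N)%N -> u i.+1 <= u i * (1 + b * a i)) ->
  u N <= u 0%N * expR (b * \sum_(i < N) a i).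
Proof.
move=> u0 b0 a0; elim: N => [|N IH] step; first by rewrite big_ord0 mulr0 expR0 mulr1.
rewrite big_ord_recr/= mulrDr expRD mulrA.
apply: (le_trans (step N _)) => //.
apply: ler_pM => //; first by rewrite addr_ge0// mulr_ge0.
  by apply: IH => i iN; apply: step; exact: ltnW.
exact: expR_ge1Dx.
Qed.

Section Discrete.
Context {R : realType} {m n : nat}.
Local Notation mu := (@lebesgue_measure R).
Variables (A : 'M[R]_(m, n)) (J : 'cV[R]_n -> R) (eta T : R).
Hypothesis A_surj : forall g : 'cV[R]_m, exists v : 'cV[R]_n, A *m v = g.

Hypothesis J_ge0 : forall v, 0 <= J v.
Hypothesis eta_gt0 : 0 < eta.
Hypothesis J1 : assumption_J1 J A.
Hypothesis J2 : assumption_J2 J eta.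
Hypothesis J3 : assumption_J3 J.
Hypothesis J4 : assumption_J4 J A eta.
Variables (f df : R -> 'cV[R]_m).
Hypothesis f_W12 : sobolev_W12 T f df.
Variable v0 : 'cV[R]_n.
Hypothesis v0_crit : critical_point J A (f 0) v0.

Lemma discrete_path : exists2 C : R, 0 <= C & forall delta : R,
  exists (V : nat -> 'cV[R]_n) (Q : nat -> 'rV[R]_m),
  [/\ V 0%N = v0, forall i, A *m V i = f (i%:R * delta),
      forall i, prox_subgradient J eta (V i) (Q i *m A)
    & forall i, J (V i.+1) <= J (V i)
        + duality (Q i) (f (i.+1%:R * delta) - f (i%:R * delta))
        + C * enorm (f (i.+1%:R * delta) - f (i%:R * delta)) ^+ 2].
Proof.
have [C C0 CP] := critical_step A_surj J_ge0 eta_gt0 J1 J2 J3 J4.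
exists C => // delta.
have [Av0 [q0 /(subdifferential_J eta_gt0 J2) sv0]] := v0_crit.
have /boolp.choice[F FP] : forall x : ('cV[R]_n * 'rV[R]_m) * 'cV[R]_m,
    exists y : 'cV[R]_n * 'rV[R]_m, prox_subgradient J eta x.1.1 (x.1.2 *m A) ->
    [/\ A *m y.1 = x.2, prox_subgradient J eta y.1 (y.2 *m A)
      & J y.1 <= J x.1.1 + duality x.1.2 (x.2 - A *m x.1.1)
        + C * enorm (x.2 - A *m x.1.1) ^+ 2].
  move=> [[v q] g] /=.
  have [sv|nsv] := pselect (prox_subgradient J eta v (q *m A)); last by exists (v, q).
  by have [w [q' ?]] := CP v q g sv; exists (w, q').
(* F picks, from a state (v, q) and the next value of f, the next state. *)
pose st := fix st i := if i is i'.+1 then F (st i', f (i%:R * delta)) else (v0, q0).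
have sub i : prox_subgradient J eta (st i).1 ((st i).2 *m A).
  by elim: i => //= i IH; have [] := FP (st i, f (i.+1%:R * delta)) IH.
have Ast i : A *m (st i).1 = f (i%:R * delta).
  case: i => [|i]; first by rewrite mul0r.
  by have [] := FP (st i, f (i.+1%:R * delta)) (sub i).
exists (fun i => (st i).1), (fun i => (st i).2); split => // i.
have [_ _ /=] := FP (st i, f (i.+1%:R * delta)) (sub i).
by rewrite Ast.
Qed.

Let D := \int[mu]_(t in `[0, T]) derivative_norm1 df t.

Let D_ge0 : 0 <= D.
Proof. by apply: Rintegral_ge0 => t _; exact: derivative_norm1_ge0. Qed.

Lemma sobolev_bounded t : 0 <= t <= T -> enorm (f t) <= m%:R * (1 * (D + enorm (f 0))).
Proof.
move=> /andP[t0 tT]; rewrite -[f t](subrK (f 0)); apply: (le_trans (enormD_le _ _)).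
rewrite !ler_wpM2l// lerD2r.
have := @sobolev_variation _ _ _ _ _ f_W12 (fun i => if i is 0%N then 0 else t) 1.
rewrite big_ord1; apply => // -[|j] //=.
Qed.

(** J + 1 grows at each step by a factor at most 1 + b |f_(i+1) - f_i|, and the
increments of f have total length at most D, whatever delta is.  The sum of
their squares, which is the error of the summed energy inequalities, is at
most omega D. *)
Lemma discrete_evolution : exists2 M : R, 0 <= M & forall delta omega : R, 0 < delta ->
  0 <= omega ->
  (forall s t : R, 0 <= s -> s <= t -> t <= T -> t <= s + delta -> enorm (f t - f s) <= omega) ->
  exists (vd : R -> 'cV[R]_n) (qd : R -> 'rV[R]_m),
  [/\ discrete_quasistatic_evolution J A T v0 f delta vd,
      (forall i j, measurable_fun (`[0, T] : set (measurableTypeR R)) (fun t => vd t i j))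
      /\ (forall i j, measurable_fun (`[0, T] : set (measurableTypeR R)) (fun t => qd t i j)),
      forall t, 0 <= t <= T -> enorm (vd t) <= M /\ enorm (qd t) <= M,
      forall t, 0 <= t <= T -> prox_subgradient J eta (vd t) (qd t *m A)
    & forall t, 0 <= t <= T ->
        J (vd t) <= J v0 + \int[mu]_(s in `[0, t]) duality (qd s) (df s) + M * omega].
Proof.
have [C C0 path] := discrete_path.
have [c c0 qle] := subgradient_multiplier_bound A_surj J_ge0 eta_gt0 J2 J3.
pose b := m%:R * c + C * D.
have b0 : 0 <= b by rewrite addr_ge0// mulr_ge0// D_ge0.
pose E := (J v0 + 1) * expR (b * D).
have E0 : 0 <= E by rewrite mulr_ge0 ?addr_ge0 ?expR_ge0.
pose F := m%:R * (1 * (D + enorm (f 0))).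
have F0 : 0 <= F by rewrite !mulr_ge0// addr_ge0 ?enorm_ge0// D_ge0.
have [Mv vle] := J1 (E + F ^+ 2).
have cE0 : 0 <= c * E by rewrite mulr_ge0.
have CD0 : 0 <= C * D by rewrite mulr_ge0// D_ge0.
have mcE0 : 0 <= m%:R * (c * E) by rewrite mulr_ge0.
exists (`|Mv| + c * E + (C * D + m%:R * (c * E))); first by rewrite !addr_ge0.
move=> delta omega delta0 omega0 mod_.
have [V [Q [V0 AV sub step]]] := path delta.
pose N := grid_index delta.
pose a i := enorm (f (i.+1%:R * delta) - f (i%:R * delta)).
have a0 i : 0 <= a i by exact: enorm_ge0.
have grid_le i : i%:R * delta <= i.+1%:R * delta :> R by rewrite ler_pM2r// ler_nat.
have suma i : i%:R * delta <= T -> \sum_(j < i) a j <= D.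
  move=> iT; apply: (sobolev_variation f_W12 (a := fun j => j%:R * delta)) => //.
  by rewrite mul0r.
have aD i : i.+1%:R * delta <= T -> a i <= D.
  by move=> /suma; rewrite big_ord_recr/=; apply: le_trans; rewrite lerDr sumr_ge0.
have Qle i : enorm (Q i) <= c * (J (V i) + 1).
  have := qle (V i) (Q i) 0; rewrite subr0 enorm0 addr0; apply; exact: sub.
have JE i : i%:R * delta <= T -> J (V i) + 1 <= E.
  move=> iT.
  have gron : J (V i) + 1 <= (J (V 0%N) + 1) * expR (b * \sum_(j < i) a j).
    apply: (discrete_gronwall (u := fun i => J (V i) + 1)) => // [j|j ji].
      by rewrite addr_ge0.
    have jT : j.+1%:R * delta <= T.
      by apply: le_trans iT; rewrite ler_pM2r// ler_nat.
    have := step j; rewrite -/(a j) => stepj.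
    have dual : duality (Q j) (f (j.+1%:R * delta) - f (j%:R * delta)) <=
        m%:R * c * (J (V j) + 1) * a j.
      apply: (le_trans (ler_norm _)); apply: (le_trans (normr_duality_le _ _)).
      by rewrite -!mulrA ler_wpM2l// -/(a j) !mulrA ler_wpM2r// Qle.
    have quad : C * a j ^+ 2 <= C * D * a j * (J (V j) + 1).
      rewrite expr2 !mulrA; apply: (@le_trans _ _ (C * D * a j)).
        by rewrite ler_wpM2r// ler_wpM2l// aD.
      by rewrite ler_peMr ?mulr_ge0// lerDr.
    by rewrite /b; lra.
  apply: (le_trans gron); rewrite V0 ler_wpM2l ?addr_ge0// ler_expR.
  by rewrite ler_wpM2l// suma.
have QE i : i%:R * delta <= T -> enorm (Q i) <= c * E.
  by move=> iT; apply: (le_trans (Qle i)); rewrite ler_wpM2l// JE.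
have NT t : 0 <= t <= T -> (N t)%:R * delta <= t /\ (N t)%:R * delta <= T.
  move=> /andP[t0 tT]; have /andP[Nt _] := grid_index_itv delta0 t0.
  by split=> //; exact: le_trans tT.
exists (fun t => V (N t)), (fun t => Q (N t)); split.
- split.
  + move=> t _; apply: cvg_near_cst.
    by apply: filterS (grid_index_right t delta0) => s; rewrite /N => ->.
  + move=> t /andP[_ td] _; rewrite /N grid_index_neg//.
  + by move=> i _ s t _ _ si ti; rewrite /N !(grid_index_def delta0 (i := i)).
  + move=> i _; have -> : N (i%:R * delta) = i.
      by apply: grid_index_def => //; rewrite lexx/= ltr_pM2r// ltr_nat.
    by split; [exact: AV|exists (Q i); apply/(subdifferential_J eta_gt0 J2)].
- split=> i j.
    by apply: (measurable_grid_step (fun k => V k i j)) => //; exact: measurable_itv.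
  by apply: (measurable_grid_step (fun k => Q k i j)) => //; exact: measurable_itv.
- move=> t t0T; have [Nt NtT] := NT t t0T; split.
    apply: le_trans (_ : Mv <= _).
      apply: vle; rewrite AV; apply: lerD; first by have := JE _ NtT; lra.
      rewrite ler_pXn2r ?nnegrE ?enorm_ge0//; apply: sobolev_bounded.
      by rewrite NtT andbT mulr_ge0// ltW.
    apply: (le_trans (ler_norm Mv)); rewrite -addrA lerDl.
    by rewrite !addr_ge0.
  apply: (le_trans (QE _ NtT)); rewrite addrAC lerDr.
  by rewrite !addr_ge0.
- by move=> t t0T; exact: sub.
pose theta s := duality (Q (N s)) (df s).
have mq j : measurable_fun (`[0, T] : set (measurableTypeR R)) (fun t => Q (N t) 0 j).
  by apply: (measurable_grid_step (fun k => Q k 0 j)) => //; exact: measurable_itv.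
have itheta : mu.-integrable `[0, T] (EFin \o theta).
  apply: (duality_derivative_integrable f_W12 (q := fun s => Q (N s)) (M := c * E)) => // t.
  by move=> /NT[_]; exact: QE.
have intS (x y : R) : 0 <= x -> y <= T -> mu.-integrable `[x, y] (EFin \o theta).
  move=> x0 yT; apply: integrable_subitv itheta => t /=.
  by rewrite !in_itv/= => /andP[? ?]; lra.
have step_integral i s : i%:R * delta <= s -> s <= i.+1%:R * delta -> s <= T ->
    \int[mu]_(t in `[i%:R * delta, s]) theta t = duality (Q i) (f s - f (i%:R * delta)).
  move=> is_ si sT; have i0 : 0 <= i%:R * delta by rewrite mulr_ge0// ltW.
  have iT := le_trans is_ sT.
  have iQ : mu.-integrable `[0, T] (EFin \o (fun t => duality (Q i) (df t))).
    by apply: (duality_derivative_integrable f_W12 (q := fun=> Q i) (M := enorm (Q i))).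
  rewrite -(sobolev_FTC_duality f_W12)// -!Rintegral_itv_bndo_bndc.
  - apply: eq_Rintegral => t; rewrite inE/= in_itv/= => /andP[it ts].
    by rewrite /theta /N (grid_index_def delta0 (i := i))// it (lt_le_trans ts si).
  - apply: integrable_subitv itheta => t /=.
    by rewrite !in_itv/= => /andP[? ?]; lra.
  - apply: integrable_subitv iQ => t /=.
    by rewrite !in_itv/= => /andP[? ?]; lra.
have aomega i : i.+1%:R * delta <= T -> a i <= omega.
  move=> iT; apply: mod_ => //; first by rewrite mulr_ge0// ltW.
  by rewrite -natr1 mulrDl mul1r.
have energy i : i%:R * delta <= T -> J (V i) <=
    J v0 + \int[mu]_(s in `[0, i%:R * delta]) theta s + C * (omega * \sum_(j < i) a j).
  elim: i => [|i IH] iT.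
    by rewrite big_ord0 !mulr0 addr0 mul0r set_itv1 Rintegral_set1 addr0 V0.
  have i0 : 0 <= i%:R * delta by rewrite mulr_ge0// ltW.
  have iT' := le_trans (grid_le i) iT.
  rewrite (Rintegral_itv_split i0 (grid_le i)); last exact: intS.
  rewrite step_integral// big_ord_recr/= mulrDr mulrDr.
  have := IH iT'; have := step i; rewrite -/(a i).
  have : C * a i ^+ 2 <= C * (omega * a i).
    by rewrite ler_wpM2l// expr2 ler_wpM2r// aomega.
  lra.
move=> t t0T; have [Nt NtT] := NT t t0T; have /andP[t0 tT] := t0T.
have Nt0 : 0 <= (N t)%:R * delta by rewrite mulr_ge0// ltW.
have /andP[_ tN] := grid_index_itv delta0 t0.
rewrite (Rintegral_itv_split Nt0 Nt); last exact: intS.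
rewrite step_integral//; last exact: ltW.
have last_ : `|duality (Q (N t)) (f t - f ((N t)%:R * delta))| <= m%:R * (c * E) * omega.
  apply: (le_trans (normr_duality_le _ _)); rewrite -mulrA ler_wpM2l// ler_pM ?enorm_ge0//.
    exact: QE.
  by apply: mod_ => //; move: tN; rewrite -natr1 mulrDl mul1r => /ltW.
have := energy _ NtT; move: last_; rewrite ler_norml => /andP[last_ _].
have : C * (omega * \sum_(j < N t) a j) <= C * D * omega.
  by rewrite -mulrA ler_wpM2l// mulrC ler_wpM2r// suma.
have : 0 <= (`|Mv| + c * E) * omega by rewrite mulr_ge0// addr_ge0.
lra.
Qed.

End Discrete.

(** * The limit evolution *)

(** A lower limit sees any selection of arbitrarily large indices. *)
Lemma limn_einf_eq0 (R : realType) (u : nat -> R) (K : nat -> nat) :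
  (forall k, 0 <= u k) -> (forall j, (j <= K j)%N) ->
  (fun j => u (K j)) @ \oo --> 0 -> limn_einf (fun k => (u k)%:E) = 0%E.
Proof.
move=> u0 jK uK.
have einfs0 N : einfs (fun k => (u k)%:E) N = 0%E.
  apply/eqP; rewrite eq_le; apply/andP; split; last first.
    by apply: le_ereal_inf_tmp => _ [k _ <-]; rewrite lee_fin.
  apply/lee_addgt0Pr => e e0; rewrite add0e.
  move/cvgr0_norm_le : uK => /(_ _ e0)[N' _ NP].
  have := NP (maxn N N') (leq_maxr _ _); rewrite /= ger0_norm// => ue.
  apply: (@le_trans _ _ (u (K (maxn N N')))%:E); last by rewrite lee_fin.
  apply: ereal_inf_lbound; exists (K (maxn N N')) => //=.
  exact: leq_trans (leq_maxl _ _) (jK _).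
rewrite limn_einf_lim (_ : einfs _ = fun=> 0%E); last exact/funext.
by apply/cvg_lim => //; exact: cvg_cst.
Qed.

Theorem theorem2p16 (R : realType) (m n : nat) (mn : (m < n)%N)
  (A : 'M[R]_(m, n)) (T : R) (T_gt0 : 0 < T)
  (A_surj : forall g : 'cV[R]_m, exists v : 'cV[R]_n, A *m v = g)
  (J : 'cV[R]_n -> R) (J_ge0 : forall v, 0 <= J v)
  (J1 : assumption_J1 J A)
  (eta : R) (eta_gt0 : 0 < eta)
  (J2 : assumption_J2 J eta)
  (J3 : assumption_J3 J)
  (J4 : assumption_J4 J A eta)
  (f df : R -> 'cV[R]_m) (f_W12 : sobolev_W12 T f df)
  (v0 : 'cV[R]_n) (v0_crit : critical_point J A (f 0) v0) :
  exists (v : R -> 'cV[R]_n) (q : R -> 'rV[R]_m),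
    [/\ bounded_on T v /\ mx_measurable_on T v,
        bounded_on T q /\ mx_measurable_on T q,
        approximable_quasistatic_evolution J A T v0 f v,
        forall t, t \in `[0, T] -> subdifferential J (v t) (q t *m A)
      & (@lebesgue_measure R).-integrable `[0, T]
          (fun s => (duality (q s) (df s))%:E) /\
        forall t, 0 < t <= T ->
          J (v t) <= J v0 +
            \int[lebesgue_measure]_(s in `[0, t]) duality (q s) (df s)].
Proof.
have [M M0 disc] := discrete_evolution A_surj J_ge0 eta_gt0 J1 J2 J3 J4 f_W12 v0_crit.
pose omega k : R := k.+1%:R^-1.
have omega0 k : 0 < omega k by rewrite invr_gt0.
have /boolp.choice[delta deltaP] : forall k, exists delta : R, [/\ 0 < delta, delta <= omega k &
    forall s t : R, 0 <= s -> s <= t -> t <= T -> t <= s + delta -> enorm (f t - f s) <= omega k].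
  move=> k; have [d d0 dP] := sobolev_modulus f_W12 (omega0 k).
  have md : 0 < Num.min d (omega k) by rewrite lt_min d0 omega0.
  exists (Num.min d (omega k) / 2); split; first by rewrite divr_gt0.
    by rewrite ler_pdivrMr// ge_min; apply/orP; right; have := omega0 k; lra.
  move=> s t s0 st tT tsd; apply/ltW/dP => //.
  have : Num.min d (omega k) <= d by rewrite ge_min lexx.
  lra.
have /boolp.choice[vq vqP] : forall k, exists vq : (R -> 'cV[R]_n) * (R -> 'rV[R]_m),
  [/\ discrete_quasistatic_evolution J A T v0 f (delta k) vq.1,
      (forall i j, measurable_fun (`[0, T] : set (measurableTypeR R)) (fun t => vq.1 t i j))
      /\ (forall i j, measurable_fun (`[0, T] : set (measurableTypeR R)) (fun t => vq.2 t i j)),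
      forall t, 0 <= t <= T -> enorm (vq.1 t) <= M /\ enorm (vq.2 t) <= M,
      forall t, 0 <= t <= T -> prox_subgradient J eta (vq.1 t) (vq.2 t *m A)
    & forall t, 0 <= t <= T -> J (vq.1 t) <= J v0
        + \int[lebesgue_measure]_(s in `[0, t]) duality (vq.2 s) (df s) + M * omega k].
  move=> k; have [d0 _ dP] := deltaP k.
  have [vd [qd P]] := disc (delta k) (omega k) d0 (ltW (omega0 k)) dP.
  by exists (vd, qd).
pose D : set (measurableTypeR R) := `[0, T]%classic.
have DP s : D s <-> 0 <= s <= T by rewrite /D/= in_itv.
have mD : measurable D by exact: measurable_itv.
pose vk k := (vq k).1; pose qk k := (vq k).2.
have mv k i j : measurable_fun D (fun t => vk k t i j) by have [_ [+ _] _ _ _] := vqP k; apply.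
have mq k i j : measurable_fun D (fun t => qk k t i j) by have [_ [_ +] _ _ _] := vqP k; apply.
have vM k t : D t -> enorm (vk k t) <= M.
  by move=> /DP t0T; have [_ _ /(_ t t0T)[]] := vqP k.
have qM k t : D t -> enorm (qk k t) <= M.
  by move=> /DP t0T; have [_ _ /(_ t t0T)[]] := vqP k.
have subk k t : D t -> prox_subgradient J eta (vk k t) (qk k t *m A).
  by move=> /DP t0T; have [_ _ _ /(_ t t0T)] := vqP k.
pose theta k s := duality (qk k s) (df s).
have mtheta k : measurable_fun D (theta k).
  by apply: measurable_duality_derivative f_W12 _ _ => j; exact: mq.
(* The dominating function of all the theta k. *)
pose G s := M * derivative_norm1 df s.
have thetaG k s : D s -> `|theta k s| <= G s.
  move=> Ds; apply: (le_trans (normr_duality_derivative _ _ _)).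
  by rewrite ler_wpM2r ?derivative_norm1_ge0// qM.
have iG : (@lebesgue_measure R).-integrable `[0, T] (EFin \o G).
  by apply: integrable_EFinZ => //; exact: derivative_norm1_integrable f_W12.
(* K1 makes theta tend to its upper limit, then L makes v and q converge. *)
have [//|s Ds|K1 [mK1 jK1 cK1]] := measurable_limsup_index mD (X := theta).
  by exists (G s) => k; exact: thetaG.
pose X (i : 'I_n + 'I_m) j s : R :=
  match i with inl i => vk (K1 j s) s i 0 | inr i => qk (K1 j s) s 0 i end.
have [||L [mL jL cL]] := measurable_cvg_index mD (X := X).
- by move=> [i|i] k; [apply: (@measurable_fun_index _ _ D mD _ _ (fun k s => vk k s i 0) (K1 k))
    |apply: (@measurable_fun_index _ _ D mD _ _ (fun k s => qk k s 0 i) (K1 k))].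
- move=> i s Ds; exists M => k; case: i => i.
    exact: le_trans (entry_le_enorm _ _ _) (vM _ _ Ds).
  exact: le_trans (entry_le_enorm _ _ _) (qM _ _ Ds).
pose K j s := K1 (L j s) s.
have jK j s : D s -> (j <= K j s)%N.
  by move=> Ds; exact: leq_trans (jL _ _ Ds) (jK1 _ _ Ds).
have mK j : measurable_fun D (K j).
  by apply: (@measurable_fun_index _ _ D mD _ _ (fun k s => K1 k s) (L j)).
pose v s : 'cV[R]_n := \col_i limn (fun j => vk (K j s) s i 0).
pose q s : 'rV[R]_m := \row_i limn (fun j => qk (K j s) s 0 i).
have cv s : D s -> ecvg (fun j => vk (K j s) s) (v s).
  by move=> Ds i j; rewrite mxE (ord1 j); exact: (cL (inl i) s Ds).
have cq s : D s -> ecvg (fun j => qk (K j s) s) (q s).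
  by move=> Ds i j; rewrite mxE (ord1 i); exact: (cL (inr j) s Ds).
have mV i j : measurable_fun D (fun s => v s i j).
  apply: (measurable_fun_cvg (h := fun k s => vk (K k s) s i j)) => [k|s Ds]; last exact: cv.
  by apply: (@measurable_fun_index _ _ D mD _ _ (fun k s => vk k s i j) (K k)).
have mQ i j : measurable_fun D (fun s => q s i j).
  apply: (measurable_fun_cvg (h := fun k s => qk (K k s) s i j)) => [k|s Ds]; last exact: cq.
  by apply: (@measurable_fun_index _ _ D mD _ _ (fun k s => qk k s i j) (K k)).
have bV s : D s -> enorm (v s) <= n%:R * (1 * M).
  move=> Ds; apply: enorm_bounded => i j.
  apply: (cvgr_to_le (cvg_norm (cv s Ds i j))); apply: nearW => k.
  exact: le_trans (entry_le_enorm _ _ _) (vM _ _ Ds).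
have bQ s : D s -> enorm (q s) <= 1 * (m%:R * M).
  move=> Ds; apply: enorm_bounded => i j.
  apply: (cvgr_to_le (cvg_norm (cq s Ds i j))); apply: nearW => k.
  exact: le_trans (entry_le_enorm _ _ _) (qM _ _ Ds).
have thetaE s : D s -> duality (q s) (df s) = limn_sup (theta ^~ s).
  move=> Ds; have c1 : (fun j => theta (K j s) s) @ \oo --> limn_sup (theta ^~ s).
    by apply: (cvg_index (u := fun j => theta (K1 j s) s) (L := fun j => L j s)) (cK1 s Ds) => j;
      exact: jL.
  apply: (cvg_unique (@Rhausdorff R) _ c1).
  by apply: cvg_duality (cq s Ds) _; exact: ecvg_cst.
exists v, q; split.
- split; last exact: mV.
  by exists (n%:R * (1 * M)) => t tT; exact: bV.
- split; last exact: mQ.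
  by exists (1 * (m%:R * M)) => t tT; exact: bQ.
- split; last 1 first.
  + exists delta, vk; split.
    * by move=> k; have [] := deltaP k.
    * apply: (@squeeze_cvgr _ _ _ _ (fun=> 0) omega); [|exact: cvg_cst|exact: cvg_harmonic].
      by apply: nearW => k; have [/ltW -> ->] := deltaP k.
    * by move=> k; have [] := vqP k.
    * move=> t tT; apply: (limn_einf_eq0 (K := fun j => K j t)).
      - by move=> k; exact: enorm_ge0.
      - by move=> j; exact: jK.
      - exact: cvg_enorm_sub (cv t tT).
  + by exists (n%:R * (1 * M)) => t tT; exact: bV.
  + exact: mV.
- move=> t tT; apply/(subdifferential_J eta_gt0 J2).
  apply: (prox_subgradient_closed (J2_convex J2) (cv t tT) (xi := fun j => qk (K j t) t *m A)).
    by apply: ecvgM (cq t tT) _; exact: ecvg_cst.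
  by move=> j; exact: subk.
- split.
    apply: (duality_derivative_integrable f_W12 (M := 1 * (m%:R * M))) => [j|t /DP]; first exact: mQ.
    exact: bQ.
  move=> t /andP[t0 tT].
  have Dt : D t by apply/DP; rewrite (ltW t0).
  have sub0t : `[0, t] `<=` D.
    by move=> s /=; rewrite /D/= !in_itv/= => /andP[? ?]; lra.
  have ub s : D s -> has_ubound (range (theta ^~ s)).
    move=> Ds; exists (G s) => _ [k _ <-]; exact: le_trans (ler_norm _) (thetaG k s Ds).
  have lb s : D s -> has_lbound (range (theta ^~ s)).
    move=> Ds; exists (- G s) => _ [k _ <-].
    by have := thetaG k s Ds; rewrite ler_norml => /andP[].
  (* Reverse Fatou: Theta k dominates theta k and decreases to limsup theta. *)
  pose Theta k s := sups (theta ^~ s) k.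
  have theta_le k s : D s -> theta k s <= Theta k s.
    move=> Ds; apply: ub_le_sup; first exact: has_ubound_sdrop (ub s Ds) k.
    by exists k => /=.
  have ThetaG k s : D s -> `|Theta k s| <= G s.
    move=> Ds; rewrite ler_norml; apply/andP; split.
      apply: le_trans (theta_le k s Ds).
      by have := thetaG k s Ds; rewrite ler_norml => /andP[].
    apply: ge_sup; first by exists (theta k s); exists k => /=.
    by move=> _ [l _ <-]; exact: le_trans (ler_norm _) (thetaG l s Ds).
  have mTheta k : measurable_fun D (Theta k) by exact: measurable_fun_sups.
  have cTheta s : D s -> (fun k => Theta k s) @ \oo --> limn_sup (theta ^~ s).
    move=> Ds; have cs := cvg_sups_inf (ub s Ds) (lb s Ds).
    by apply/cvg_ex; eexists; exact: cs.
  have m0t : measurable (`[0, t] : set (measurableTypeR R)) by exact: measurable_itv.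
  have int0t (h : R -> R) : (@lebesgue_measure R).-integrable `[0, T] (EFin \o h) ->
      (@lebesgue_measure R).-integrable `[0, t] (EFin \o h).
    exact: integrable_subitv.
  have [|||k s /sub0t|_ cint] := @dominated_Rintegral _ _ R (@lebesgue_measure R) _ Theta
    (fun s => limn_sup (theta ^~ s)) G m0t.
  + by move=> k; exact: measurable_funS sub0t (mTheta k).
  + by move=> s /sub0t; exact: cTheta.
  + exact: int0t.
  + exact: ThetaG.
  have energy k : J (vk k t) <=
      J v0 + \int[lebesgue_measure]_(s in `[0, t]) Theta k s + M * omega k.
    have [_ _ _ _ /(_ t)] := vqP k; rewrite (ltW t0) tT => /(_ isT) /le_trans; apply.
    rewrite lerD2r lerD2l; apply: le_Rintegral => //.
    * apply: int0t; apply: le_integrable iG => //; first by apply/measurable_EFinP; exact: mtheta.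
      by move=> s Ds; rewrite lee_fin [leRHS]ger0_norm ?thetaG//; apply: le_trans (thetaG 0%N s Ds).
    * apply: int0t; apply: le_integrable iG => //; first by apply/measurable_EFinP; exact: mTheta.
      by move=> s Ds; rewrite lee_fin [leRHS]ger0_norm ?ThetaG//; apply: le_trans (thetaG 0%N s Ds).
    * by move=> s /sub0t; exact: theta_le.
  have -> : \int[lebesgue_measure]_(s in `[0, t]) duality (q s) (df s) =
      \int[lebesgue_measure]_(s in `[0, t]) limn_sup (theta ^~ s).
    by apply: eq_Rintegral => s; rewrite inE => /sub0t; exact: thetaE.
  have cR : (fun k => J v0 + \int[lebesgue_measure]_(s in `[0, t]) Theta k s + M * omega k) @ \oo
      --> J v0 + \int[lebesgue_measure]_(s in `[0, t]) limn_sup (theta ^~ s) + M * 0.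
    apply: cvgD; first by apply: cvgD => //; exact: cvg_cst.
    by apply: cvgMl_tmp; exact: cvg_harmonic.
  rewrite -[leRHS]addr0 -[X in _ <= _ + X](mulr0 M).
  apply: (ler_cvg_to (J_continuous J2 (cv t Dt))
    (cvg_index (L := fun j => K j t) (fun j => jK j t Dt) cR)).
  by apply: nearW => j; exact: energy.
Qed.
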